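(* Let $n\ge 2$ and let $q:\mathbb{Q}^{n+1}\to\mathbb{Q}$ be either $q(t_0,\dots,t_n)=t_0^2-a_1t_1^2-\cdots-a_nt_n^2$ with integers $a_1,\dots,a_n$, $a_1>0$ not a square, or $q(t_0,\dots,t_n)=t_0t_1-a_2t_2^2-\cdots-a_nt_n^2$ with integers $a_2,\dots,a_n$, $a_2\ne0$. Let $Z=Z(q_\mathbb{R})$, $E=\mathbb{P}^n(\mathbb{Q})\setminus Z$, and let $\rho=\rho_n$ be the unique positive root of $x^n-(x^{n-1}+\cdots+x+1)$. Then there exists an unbounded sequence $(\mathbf{x}_i)_{i\ge0}$ in $\mathbb{Z}^{n+1}$ such that, with $X_i=\|\mathbf{x}_i\|$, for each $i\ge 0$: (i) $\mathbf{x}_{i+n+1}=\psi(\mathbf{x}_{i+n},\mathbf{x}_i)$; (ii) $q(\mathbf{x}_i)=1$; (iii) $|\det(\mathbf{x}_i,\dots,\mathbf{x}_{i+n})|=|\det(\mathbf{x}_0,\dots,\mathbf{x}_n)|\ne0$; (iv) $X_{i+1}\asymp X_i^\rho$; (v) $\|\mathbf{x}_{i+1}\wedge\mathbf{x}_i\|\asymp X_{i+1}/X_i$, with implied constants independent of $i$. The image $([\mathbf{x}_i])_{i\ge0}$ of this sequence in $\mathbb{P}^n(\mathbb{R})$ converges to a point $\xi\in Z^{\mathrm{li}}$ with $D_\xi(\mathbf{x}_i)\asymp X_i^{-1}$, and this point satisfies $\limsup_{X\to\infty}X^{1/\rho}\mathcal{D}_\xi(X;E)<\infty$.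
   Context: $b(\mathbf{x},\mathbf{y})=q(\mathbf{x}+\mathbf{y})-q(\mathbf{x})-q(\mathbf{y})$ and $\psi(\mathbf{x},\mathbf{y})=b(\mathbf{x},\mathbf{y})\mathbf{x}-q(\mathbf{x})\mathbf{y}$. $q_\mathbb{R}$ is $q$ extended to $\mathbb{R}^{n+1}$ and $Z(q_\mathbb{R})$ its zero set in $\mathbb{P}^n(\mathbb{R})$; $Z^{\mathrm{li}}$ is the set of points of $Z$ with representatives having $\mathbb{Q}$-linearly independent coordinates. Norms are Euclidean on $\mathbb{R}^{n+1}$ and on $\bigwedge^2\mathbb{R}^{n+1}$ ($\mathbf{e}_i\wedge\mathbf{e}_j$, $i<j$, orthonormal). $D_\xi(\mathbf{x})=\|\mathbf{x}\wedge\boldsymbol{\xi}\|/\|\boldsymbol{\xi}\|$ for $\xi=[\boldsymbol{\xi}]$; $\mathcal{D}_\xi(X;E)=\min\{D_\xi(\mathbf{x}):\mathbf{x}\in\mathbb{Z}^{n+1}\setminus\{0\},\|\mathbf{x}\|\le X,[\mathbf{x}]\in E\}$ (with $\min\emptyset=-\infty$). $A\asymp B$ means $A\ll B\ll A$. *)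

(* Defs.v *)
From HB Require Import structures.
From mathcomp Require Import all_boot all_order all_algebra.
From mathcomp Require Import generic_quotient.
From mathcomp Require Import zify.
From mathcomp Require Import all_classical all_reals all_analysis.

Set Implicit Arguments.
Unset Strict Implicit.
Unset Printing Implicit Defensive.
Import Order.TTheory GRing.Theory Num.Theory.
Import numFieldNormedType.Exports.
Local Open Scope classical_set_scope.
Local Open Scope ring_scope.
Local Open Scope quotient_scope.

Definition ivec (K : pzRingType) m (x : 'rV[int]_m) : 'rV[K]_m :=
  map_mx intr x.

Definition polar (K : pzRingType) m (q : 'rV[K]_m -> K) (x y : 'rV[K]_m) : K :=
  q (x + y) - q x - q y.

Definition psi (K : pzRingType) m (q : 'rV[K]_m -> K) (x y : 'rV[K]_m) :
  'rV[K]_m := polar q x y *: x - q x *: y.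

(* The two families of forms; the index set {0,...,n} of the coordinates is
   'I_n.+1, and values of a outside the index range are irrelevant. *)
Definition diag_form n (q : 'rV[rat]_n.+1 -> rat) : Prop :=
  exists a : nat -> int,
    [/\ 0 < a 1%N,
        ~ (exists k : int, a 1%N = k ^+ 2) &
        forall t : 'rV[rat]_n.+1,
          q t = t 0 ord0 ^+ 2
                - \sum_(1 <= i < n.+1) (a i)%:~R * t 0 (inord i) ^+ 2].

Definition hyp_form n (q : 'rV[rat]_n.+1 -> rat) : Prop :=
  exists a : nat -> int,
    a 2%N != 0 /\
    forall t : 'rV[rat]_n.+1,
      q t = t 0 ord0 * t 0 (inord 1)
            - \sum_(2 <= i < n.+1) (a i)%:~R * t 0 (inord i) ^+ 2.

(* Extension of scalars of a quadratic form q over Q: the form on R^m with the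
   same coefficients, which are q(e_i) on t_i^2 and b(e_i, e_j) on t_i t_j. *)
Definition qext (R : realType) m (q : 'rV[rat]_m -> rat) (t : 'rV[R]_m) : R :=
  \sum_(i < m) ratr (q (delta_mx 0 i)) * t 0 i ^+ 2
  + \sum_(i < m) \sum_(j < m | (i < j)%N)
      ratr (polar q (delta_mx 0 i) (delta_mx 0 j)) * t 0 i * t 0 j.

Definition enorm (R : realType) m (x : 'rV[R]_m) : R :=
  Num.sqrt (\sum_(i < m) x 0 i ^+ 2).

(* x /\ y as the antisymmetric matrix whose (i, j) entry, for i < j, is the
   coordinate on e_i /\ e_j. *)
Definition wedge (R : realType) m (x y : 'rV[R]_m) : 'M[R]_m :=
  x^T *m y - y^T *m x.

Definition wnorm (R : realType) m (w : 'M[R]_m) : R :=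
  Num.sqrt (\sum_(i < m) \sum_(j < m | (i < j)%N) w i j ^+ 2).

(* P^n(R) is the topological quotient of R^{n+1} \ {0} by proportionality. *)
Definition nzvec (R : realType) n : Type :=
  set_type [set v : 'rV[R]_n.+1 | v != 0].

HB.instance Definition _ (R : realType) n := Topological.on (nzvec R n).
HB.instance Definition _ (R : realType) n := SubType.on (nzvec R n).

Definition prop_rel (R : realType) n (u v : nzvec R n) : bool :=
  `[< exists2 c : R, c != 0 & val u = c *: val v >].

Lemma prop_rel_refl (R : realType) n : reflexive (@prop_rel R n).
Proof. by move=> u; apply/asboolP; exists 1; rewrite ?oner_neq0 ?scale1r. Qed.

Lemma prop_rel_sym (R : realType) n : symmetric (@prop_rel R n).
Proof.
suff H (u v : nzvec R n) : prop_rel u v -> prop_rel v u.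
  by move=> u v; apply/idP/idP; exact: H.
move=> /asboolP[c c0 uv]; apply/asboolP; exists c^-1; first by rewrite invr_eq0.
by rewrite uv scalerA mulVf// scale1r.
Qed.

Lemma prop_rel_trans (R : realType) n : transitive (@prop_rel R n).
Proof.
move=> v u w /asboolP[c c0 uv] /asboolP[d d0 vw]; apply/asboolP.
by exists (c * d); rewrite ?mulf_neq0// uv vw scalerA.
Qed.

Definition prop_equiv (R : realType) n : equiv_rel (nzvec R n) :=
  EquivRel (@prop_rel R n) (@prop_rel_refl R n) (@prop_rel_sym R n)
    (@prop_rel_trans R n).

Definition projspace (R : realType) n : Type :=
  quotient_topology {eq_quot @prop_equiv R n}.

HB.instance Definition _ (R : realType) n := Topological.on (projspace R n).
HB.instance Definition _ (R : realType) n := Quotient.on (projspace R n).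

Fact e0_neq0 (R : realType) n :
  (delta_mx 0 ord0 : 'rV[R]_n.+1) \in [set v : 'rV[R]_n.+1 | v != 0].
Proof.
apply/mem_set/eqP => /matrixP /(_ 0 ord0); rewrite !mxE !eqxx => /eqP.
by rewrite oner_eq0.
Qed.

Definition e0_nz (R : realType) n : nzvec R n :=
  exist (fun v => v \in [set v : 'rV[R]_n.+1 | v != 0]) _ (e0_neq0 R n).

(* The point [v]; only meaningful for v != 0 (the value at 0 is arbitrary). *)
Definition pt (R : realType) n (v : 'rV[R]_n.+1) : projspace R n :=
  \pi_(projspace R n) (insubd (e0_nz R n) v).

Definition rvec (R : realType) n (p : projspace R n) : 'rV[R]_n.+1 := val (repr p).

Definition Zset (R : realType) n (q : 'rV[rat]_n.+1 -> rat) :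
  set (projspace R n) :=
  [set pt v | v in [set v : 'rV[R]_n.+1 | v != 0 /\ qext q v = 0]].

Definition ratpts (R : realType) n : set (projspace R n) :=
  [set pt (map_mx ratr v : 'rV[R]_n.+1) | v in [set v : 'rV[rat]_n.+1 | v != 0]].

Definition Q_lin_indep (R : realType) m (v : 'rV[R]_m) : Prop :=
  forall c : 'I_m -> rat,
    \sum_(i < m) ratr (c i) * v 0 i = 0 -> forall i, c i = 0.

Definition Zli (R : realType) n (q : 'rV[rat]_n.+1 -> rat) : set (projspace R n) :=
  Zset q `&` [set pt v | v in [set v : 'rV[R]_n.+1 | v != 0 /\ Q_lin_indep v]].

(* The value does not depend on the representative rvec xi of xi. *)
Definition Dist (R : realType) n (xi : projspace R n) (x : 'rV[int]_n.+1) : R :=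
  wnorm (wedge (ivec R x) (rvec xi)) / enorm (rvec xi).

Definition Dist_values (R : realType) n (xi : projspace R n) (X : R)
    (E : set (projspace R n)) : set R :=
  [set Dist xi x | x in [set x : 'rV[int]_n.+1 |
    [/\ x != 0, enorm (ivec R x) <= X & E (pt (ivec R x))]]].

(* Minimum with value -oo on the empty set.  This is only used for sets that
   are either empty or have a least element, see calD_attained. *)
Definition min_or_ninfty (R : realType) (S : set R) : \bar R :=
  xget -oo%E [set m%:E | m in S `&` lbound S].

Definition calD (R : realType) n (xi : projspace R n) (X : R)
    (E : set (projspace R n)) : \bar R := min_or_ninfty (Dist_values xi X E).

Lemma calD_attained (R : realType) n (xi : projspace R n) (X : R)
    (E : set (projspace R n)) : Dist_values xi X E !=set0 ->
  exists m : R, [/\ Dist_values xi X E m, lbound (Dist_values xi X E) m &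
    calD xi X E = m%:E].
Proof.
move=> S0.
suff [m [Sm lm]] : Dist_values xi X E `&` lbound (Dist_values xi X E) !=set0.
  have : [set m%:E | m in Dist_values xi X E `&` lbound (Dist_values xi X E)]
      (calD xi X E).
    by apply: (@xgetPex _ -oo%E); exists m%:E, m.
  by case=> m' [Sm' lm'] mE; exists m'.
have [N XN] : exists N : nat, X <= N%:R.
  exists (Num.bound `|X|); apply/ltW/(le_lt_trans (ler_norm X)).
  exact: archi_boundP.
pose P (x : 'rV[int]_n.+1) := [/\ x != 0, enorm (ivec R x) <= X & E (pt (ivec R x))].
pose g (k : {ffun 'I_n.+1 -> 'I_(N.*2.+1)}) : 'rV[int]_n.+1 :=
  \row_i ((k i : nat)%:Z - N%:Z).
have gP (x : 'rV[int]_n.+1) : P x -> exists k, g k = x.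
  move=> [_ xX _].
  have xN i : (`|x 0 i| <= N%:Z)%R.
    rewrite -(@ler_int R) intr_norm (le_trans _ XN)// (le_trans _ xX)//.
    rewrite -sqrtr_sqr ler_wsqrtr// (bigD1 i)//= mxE lerDl.
    by apply: sumr_ge0 => j _; exact: sqr_ge0.
  exists [ffun i => inord `|(x 0%R i + N%:Z)%R|%N].
  apply/rowP => i; rewrite !mxE ffunE inordK; last first.
    by have := xN i; lia.
  by have := xN i; lia.
have [s [x Px _]] := S0.
have [k0 gk0] := gP _ Px.
have Pk0 : `[< P (g k0) >] by apply/asboolP; rewrite gk0.
case: (@Order.TotalTheory.arg_minP _ R _ k0 (fun k => `[< P (g k) >])
         (fun k => Dist xi (g k)) Pk0) => k /asboolP Pk kmin.
exists (Dist xi (g k)); split; first by exists (g k).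
move=> _ [y Py <-]; have [l gl] := gP _ Py.
by rewrite -gl; apply: kmin; apply/asboolP; rewrite gl.
Qed.

Definition ll (R : realType) (u v : nat -> R) : Prop :=
  exists2 C : R, 0 < C & forall i, u i <= C * v i.

Definition asymp (R : realType) (u v : nat -> R) : Prop := ll u v /\ ll v u.

Definition rho_poly (R : realType) n : {poly R} := 'X^n - \sum_(k < n) 'X^k.

Lemma rho_exists_unique (R : realType) n : (2 <= n)%N ->
  exists! r : R, 0 < r /\ root (rho_poly R n) r.
Proof.
move=> n2.
have E (x : R) : (rho_poly R n).[x] = x ^+ n - \sum_(k < n) x ^+ k.
  rewrite /rho_poly !hornerE horner_sum; congr (_ - _).
  by apply: eq_bigr => k _; rewrite !hornerE.
have [r] : exists2 r : R, 1 <= r <= 2 & root (rho_poly R n) r.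
  apply: poly_ivt; first by rewrite ler1n.
  have e1 : (rho_poly R n).[1] = 1 - n%:R.
    rewrite E expr1n; under eq_bigr do rewrite expr1n.
    by rewrite sumr_const card_ord.
  have e2 : (rho_poly R n).[2] = 1.
    rewrite E; have := subrX1 (2 : R) n; rewrite (_ : 2 - 1 = 1); last first.
      by rewrite [X in X - 1](natrD R 1 1) addrK.
    by rewrite mul1r => <-; rewrite opprB addrC subrK.
  by rewrite e1 e2 ler01 andbT subr_le0 ler1n (leq_trans _ n2).
move=> /andP[r1 _] rr; exists r; split.
  by split => //; exact: lt_le_trans r1.
have K (x y : R) : 0 < x -> x < y -> root (rho_poly R n) x ->
    ~ root (rho_poly R n) y.
  move=> x0 xy; rewrite /root !E !subr_eq0 => /eqP xe /eqP ye.
  have y0 : 0 < y by exact: lt_trans xy.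
  have : x ^+ n * y ^+ n < x ^+ n * y ^+ n; last by rewrite ltxx.
  rewrite [X in _ * X < _]ye [X in _ < X * _]xe mulr_suml mulr_sumr.
  have n0 : (0 < n)%N by exact: leq_trans n2.
  have D k : (k < n)%N -> x ^+ n * y ^+ k < x ^+ k * y ^+ n.
    move=> kn; rewrite -(subnKC (ltnW kn)) !exprD.
    rewrite mulrAC [ltRHS]mulrA ltr_pM2l ?mulr_gt0 ?exprn_gt0//.
    by rewrite ltrXn2r ?subn_gt0 ?ltW// -?lt0n ?subn_gt0.
  apply: ltr_sum => [|i _]; last by rewrite D.
  by apply/hasP; exists (Ordinal n0); rewrite ?mem_index_enum.
move=> s [s0 rs]; have [rs'|sr|//] := ltgtP r s.
  by have := K _ _ (lt_le_trans ltr01 r1) rs' rr.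
by have := K _ _ s0 sr rs.
Qed.

(* Main.v *)
(** Write [B j l = b(x_j, x_l)] and [beta_j = B (j+1) j].  As [q] is 1 along the
    sequence, the recursion reads [x_{j+1} = beta_j x_j - x_{j-n}] with
    [beta_j = B j (j-n)]; it preserves [q = 1] and is unimodular on windows of
    [n+1] vectors.  If the starting vectors satisfy [|B k l| >= 3] for [l < k],
    nondecreasingly in [k], then so does the whole sequence, [|B k l|] at least
    doubles with [k], and [|B j l|] is comparable to [P_j / P_l] for
    [P_j = prod_{k<j} |beta_k|].  For [l = j-n] this gives
    [P_{j+1} P_{j-n} / P_j^2 = 1 + O(2^{-j})], and since
    [x^{n+1} - 2 x^n + 1 = (x - rho) (x^n - convex combination)], taking
    logarithms yields [P_{j+1} ~ P_j^rho].  The vectors [x_j], rescaled by the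
    signed products, converge to [xi].  The wedges [x_j /\ x_l] obey the same
    recursion as [B j l], hence the same upper bound, and contracting them with
    [b(x_j, -)] bounds them below by [|B j l|]; letting [j] tend to infinity
    gives [|xi /\ x_l| ~ 1 / P_l].  Starting vectors come from orbits of a Pell
    unit, respectively from the points [(1 + Q(s), 1, s)]. *)

Require Import Defs.
From HB Require Import structures.
From mathcomp Require Import all_boot all_order all_algebra.
From mathcomp Require Import generic_quotient.
From mathcomp Require Import zify ring lra.
From mathcomp Require Import all_classical all_reals all_analysis.

Set Implicit Arguments.
Unset Strict Implicit.
Unset Printing Implicit Defensive.
Import Order.TTheory GRing.Theory Num.Theory.
Import numFieldNormedType.Exports.
Local Open Scope classical_set_scope.
Local Open Scope ring_scope.

(** * Pell's equation *)

(** The recursion is treated as a perturbation of multiplication by beta_j. What has to be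
    controlled is the error relative to the main term: the threshold 3 turns into doubling, doubling
    makes the relative errors geometric, and their products are then bounded independently of the
    index. The reference scale is P_j rather than the norm X_j because P_j obeys an exact product
    rule; the two are compared afterwards. The condition q = 1 does double work: it reduces psi(x,
    y) to b(x, y) x - y, an isometric and unimodular step, and it keeps every [x_i] outside Z, so
    that the x_i themselves compete in the minimum over E. The exponent 1/rho appears because x_i
    serves every height between X_i and X_{i+1}, and 1/X_i is comparable to X_{i+1}^{-1/rho}. *)

Lemma sqr_quotient_is_sqr (D x y : int) :
  y != 0 -> x ^+ 2 = D * y ^+ 2 -> exists k : int, D = k ^+ 2.
Proof.
move=> y0 e.
have : (y ^+ 2 %| x ^+ 2)%Z by rewrite e dvdz_mull.
rewrite dvdzE !abszX dvdn_pexp2r// -dvdzE => /dvdzP[k xk].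
exists k; apply: (@mulIf _ (y ^+ 2)); first by rewrite expf_neq0.
by rewrite -e xk exprMn.
Qed.

(* A state is a unimodular pair of vectors [(a, b)], [(c, d)] on which the form
   [X^2 - D Y^2] is positive, resp. negative; a step replaces one of them by
   their sum.  The form read in this basis has constant discriminant and
   coefficients of opposite signs, so only finitely many forms occur; two states
   with the same form differ by an automorph, whose first column solves Pell's
   equation. *)
Section PellStates.
Variable D : int.
Hypothesis Dnsq : ~ exists k : int, D = k ^+ 2.

Definition pell_form (x y : int) : int := x ^+ 2 - D * y ^+ 2.

Let state : Type := (int * int * (int * int))%type.

Definition pell_step (s : state) : state :=
  let: (a, b, (c, d)) := s in
  if 0 < pell_form (a + c) (b + d) then (a + c, b + d, (c, d))
  else (a, b, (a + c, b + d)).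

Definition pell_inv (s : state) : Prop :=
  let: (a, b, (c, d)) := s in
  [/\ 0 < b, 0 < d, a * d - b * c = 1, 0 < pell_form a b & pell_form c d < 0].

Lemma pell_step_inv s : pell_inv s -> pell_inv (pell_step s).
Proof.
case: s => -[a b] [c d] [b0 d0 det A0 C0] /=.
have w0 : pell_form (a + c) (b + d) != 0.
  apply/eqP => /eqP; rewrite subr_eq0 => /eqP e.
  by apply: Dnsq; apply: sqr_quotient_is_sqr e; lia.
by case: ifPn => w; split=> //; lia.
Qed.

Lemma pell_step_lt s : pell_inv s ->
  s.1.2 + s.2.2 < (pell_step s).1.2 + (pell_step s).2.2.
Proof. case: s => -[a b] [c d] [b0 d0 _ _ _] /=; case: ifP => _ /=; lia. Qed.

(** The coefficients A, B, C of the form A U^2 + 2 B U V + C V^2 that X^2 - D Y^2 becomes in the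
    basis given by the state. *)
Definition pell_disc (s : state) : int * int * int :=
  let: (a, b, (c, d)) := s in
  (pell_form a b, a * c - D * b * d, pell_form c d).

(** Unimodularity gives B^2 - A C = D, and since A > 0 > C this writes D as a sum of two nonnegative
    integers, the second one a product of positive factors. *)
Lemma pell_disc_bound s : pell_inv s ->
  [/\ 0 < (pell_disc s).1.1 <= D, `|(pell_disc s).1.2| <= D &
      0 < - (pell_disc s).2 <= D].
Proof.
case: s => -[a b] [c d] [b0 d0 det A0 C0] /=.
have e : (a * c - D * b * d) ^+ 2 + pell_form a b * - pell_form c d = D.
  have : D * (a * d - b * c) ^+ 2 = D by rewrite det expr1n mulr1.
  by move=> {2}<-; rewrite /pell_form; ring.
move: e A0 C0; move: (pell_form _ _) (pell_form _ _) (_ - _) => A C B e A0 C0.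
by split; nia.
Qed.

Lemma pell_of_states s t : pell_inv s -> pell_inv t ->
  s.1.2 + s.2.2 < t.1.2 + t.2.2 -> pell_disc s = pell_disc t ->
  exists x y : int, y != 0 /\ x ^+ 2 - D * y ^+ 2 = 1.
Proof.
case: s t => -[a b] [c d] [[a' b'] [c' d']] [b0 d0 det A0 C0].
move=> [b0' d0' det' A0' C0'] /= lt [eA eB eC].
(* As (1, 0) = d (a, b) - b (c, d), this is the image of (1, 0) under the linear map that sends the
   basis of [s] to that of [t]. *)
exists (d * a' - b * c'), (d * b' - b * d'); split.
  (* If y = 0, then (b', d') is a positive integer multiple of (b, d), and the factor divides det' =
     1; so b' = b and d' = d, against [lt]. *)
  apply/eqP => /eqP; rewrite subr_eq0 => /eqP y0.
  have e1 : b' = b * (a * d' - c * b').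
    rewrite -[LHS]mulr1 -det; transitivity (a * (d * b') - b * c * b'); first by ring.
    by rewrite y0; ring.
  have e2 : d' = d * (a * d' - c * b').
    rewrite -[LHS]mulr1 -det; transitivity (a * d * d' - c * (b * d')); first by ring.
    by rewrite -y0; ring.
  move: e1 e2; set t := a * d' - c * b' => e1 e2.
  have : t * (a' * d - b * c') = 1 by rewrite -det' e1 e2; ring.
  have t0 : 0 < t by rewrite -(pmulr_rgt0 _ b0) -e1.
  have t1 u : t * u = 1 -> t = 1.
    move=> tu; have u0 : 0 < u by rewrite -(pmulr_rgt0 _ t0) tu.
    by nia.
  by move=> /t1 {}t1; rewrite t1 !mulr1 in e1 e2; lia.
have -> : (d * a' - b * c') ^+ 2 - D * (d * b' - b * d') ^+ 2 =
   d ^+ 2 * pell_form a' b' - 2 * b * d * (a' * c' - D * b' * d')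
   + b ^+ 2 * pell_form c' d' by rewrite /pell_form; ring.
rewrite -eA -eB -eC /pell_form.
transitivity ((a * d - b * c) ^+ 2); last by rewrite det expr1n.
by ring.
Qed.

Lemma pell_solution : 0 < D -> exists x y : int, [/\ 0 < x, 0 < y &
  x ^+ 2 - D * y ^+ 2 = 1].
Proof.
move=> D0.
have [s [s0 sD Ds]] : exists s : int, [/\ 0 <= s, s ^+ 2 < D & D < (s + 1) ^+ 2].
  have ex : exists k : nat, (`|D| < k.+1 ^ 2)%N by exists `|D|%N; lia.
  have := ex_minnP ex => -[k kD kmin]; exists k%:Z.
  have k2 : k%:Z ^+ 2 <= D.
    case: k kD kmin => [|k] kD kmin; first by rewrite expr0n /= ltW.
    have := kmin k; case: ltnP => h; last by lia.
    by move=> /(_ isT); rewrite ltnn.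
  split; [by []| |lia].
  by rewrite lt_neqAle k2 andbT; apply/eqP => e; apply: Dnsq; exists k%:Z.
(* With s the integer part of the square root of D, these two vectors lie on either side of the
   isotropic line. *)
pose s0' : state := (s + 1, 1, (s, 1)).
have inv0 : pell_inv s0' by rewrite /pell_inv /pell_form /s0'; split; lia.
pose S i := iter i pell_step s0'.
have invS i : pell_inv (S i) by elim: i => //= i; apply: pell_step_inv.
have ltS i j : (i < j)%N -> (S i).1.2 + (S i).2.2 < (S j).1.2 + (S j).2.2.
  elim: j => // j IH; rewrite ltnS leq_eqVlt => /orP[/eqP->|/IH h].
    exact: pell_step_lt.
  by apply: lt_trans h _; apply: pell_step_lt.
pose N := `|D|%N.+1.
(* The middle coefficient can be negative, hence the shift by D before it is encoded in a finite
   type; the pigeonhole principle then applies. *)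
pose code i : 'I_N * 'I_(`|D| * 2).+1 * 'I_N :=
  let t := pell_disc (S i) in
  (inord `|t.1.1|%N, inord `|(t.1.2 + D)%R|%N, inord `|t.2|%N).
have [i [j [ij e]]] : exists i j, (i < j)%N /\ code i = code j.
  pose F (k : 'I_(#|{: 'I_N * 'I_(`|D| * 2).+1 * 'I_N}|.+1)) := code k.
  have : ~~ injectiveb F.
    apply/negP => /injectiveP /leq_card; rewrite card_ord ltnn//.
  case/injectivePn => i [j ij e].
  case: (ltngtP i j) => [h|h|/val_inj h]; [by exists i, j|by exists j, i|].
  by rewrite h eqxx in ij.
have ed : pell_disc (S i) = pell_disc (S j).
  move: e; rewrite /code; have := pell_disc_bound (invS i).
  have := pell_disc_bound (invS j).
  case: (pell_disc (S i)) (pell_disc (S j)) => [[A B] C] [[A' B'] C'] /=.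
  move=> [h1 h2 h3] [h4 h5 h6] [].
  move=> /(congr1 val) e1 /(congr1 val) e2 /(congr1 val) e3.
  move: e1 e2 e3; rewrite /= !inordK /N; try lia.
  by move=> e1 e2 e3; congr (_, _, _); lia.
have [x [y [y0 e1]]] := pell_of_states (invS i) (invS j) (ltS _ _ ij) ed.
exists `|x|, `|y|; split; [|by rewrite normr_gt0|by rewrite !real_normK ?num_real].
rewrite normr_gt0; apply/eqP => x0; move: e1; rewrite x0; nia.
Qed.
End PellStates.

(** * Starting vectors *)

(** The matrix need not be symmetric: q(x) is [bil A x x] and its polar form is [bil (A + A^T)], so
    that t_0 t_1 has an integral matrix too. *)
Definition bil (K : pzRingType) m (S : 'M[K]_m) (x y : 'rV[K]_m) : K :=
  (x *m S *m y^T) 0 0.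

Lemma bilE (K : pzRingType) m (S : 'M[K]_m) (x y : 'rV[K]_m) :
  bil S x y = \sum_j \sum_i x 0 i * S i j * y 0 j.
Proof.
rewrite /bil mxE; apply: eq_bigr => j _.
by rewrite !mxE mulr_suml; apply: eq_bigr.
Qed.

Lemma bil_addmx (K : pzRingType) m (S T : 'M[K]_m) x y :
  bil (S + T) x y = bil S x y + bil T x y.
Proof. by rewrite /bil mulmxDr mulmxDl mxE. Qed.

Lemma bil_diag (K : pzRingType) m (d x y : 'rV[K]_m) :
  bil (diag_mx d) x y = \sum_i x 0 i * d 0 i * y 0 i.
Proof.
by rewrite /bil mul_mx_diag mxE; apply: eq_bigr => i _; rewrite !mxE.
Qed.

Lemma bil_delta (K : pzRingType) m (i j : 'I_m) (x y : 'rV[K]_m) :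
  bil (delta_mx i j) x y = x 0 i * y 0 j.
Proof.
rewrite bilE (bigD1 j)//= (bigD1 i)//= mxE !eqxx mulr1 !big1 ?addr0//.
- by move=> l lj; apply: big1 => k _; rewrite mxE (negPf lj) andbF mulr0 mul0r.
- by move=> k ki; rewrite mxE (negPf ki) mulr0 mul0r.
Qed.

Lemma bil_tr (K : comPzRingType) m (S : 'M[K]_m) x y : bil S^T x y = bil S y x.
Proof.
rewrite /bil; transitivity ((y *m S *m x^T)^T 0 0); last by rewrite mxE.
by rewrite !trmx_mul trmxK mulmxA.
Qed.

(** Here [G k m l m'] stands for the value of b at the k-th vector with parameter m and the l-th
    with parameter m'. The parameters are chosen one after the other, each large enough with respect
    to the earlier ones. *)
Lemma increasing_params (G : nat -> nat -> nat -> nat -> int) (N : nat) :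
  (forall k k' m' (K : int), (k' < k <= N)%N ->
     exists M, forall m, (M <= m)%N -> K <= `|G k m k' m'|) ->
  exists m : nat -> nat,
    (forall l k, (l < k <= N)%N ->
       (m l < m k)%N /\ 3 <= `|G k (m k) l (m l)|) /\
    (forall l k, (l < k < N)%N ->
       `|G k (m k) l (m l)| <= `|G k.+1 (m k.+1) l (m l)|).
Proof.
elim: N => [|N IH] HG; first by exists (fun=> 0%N); split=> l k; lia.
case: IH => [k k' m' K h|m [m1 m2]]; first by apply: HG; lia.
(* For l < N the new value must exceed both 3 and the value in the previous row; for l = N there is
   no previous value to compare with. *)
pose K l := if (l < N)%N then `|G N (m N) l (m l)| + 3 else 3.
have [Mf MfP] : exists f : nat -> nat, forall l, (l <= N)%N ->
    forall m0, (f l <= m0)%N -> K l <= `|G N.+1 m0 l (m l)|.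
  suff /choice[f fP] : forall l, exists M, (l <= N)%N ->
    forall m0, (M <= m0)%N -> K l <= `|G N.+1 m0 l (m l)| by exists f.
  move=> l; case: (leqP l N) => [lN|_]; last by exists 0%N.
  by have [|M MP] := HG N.+1 l (m l) (K l); [lia|exists M => _].
pose M := (\sum_(l < N.+1) (Mf l + (m l).+1))%N.
have Ml l : (l <= N)%N -> (Mf l <= M /\ m l < M)%N.
  rewrite -ltnS => lN; rewrite /M (bigD1 (Ordinal lN))//=; lia.
exists (fun k => if k == N.+1 then M else m k); split=> l k h.
  have -> : (l == N.+1) = false by lia.
  case: eqP => [->|kN]; last by apply: m1; lia.
  have [a b] := Ml l ltac:(lia); split=> //.
  have := MfP l ltac:(lia) M a; rewrite /K; case: ifP => _; lia.
have -> : (l == N.+1) = false by lia.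
have -> : (k == N.+1) = false by lia.
rewrite eqSS; case: eqP => [->|kN]; last by apply: m2; lia.
have [a b] := Ml l ltac:(lia).
have := MfP l ltac:(lia) M a; rewrite /K; case: ifP => h'; lia.
Qed.

Lemma det_row_fun_neq0 n (F : nat -> nat -> int) :
  (forall c : nat -> int,
     (forall k, (k <= n)%N -> \sum_(0 <= i < n.+1) c i * F k i = 0) ->
     forall i, (i <= n)%N -> c i = 0) ->
  \det (\matrix_(k < n.+1) (\row_(i < n.+1) F k i)) != 0.
Proof.
move=> H; rewrite -det_tr; apply/det0P => -[v v0 vA].
case/eqP: v0; apply/rowP => i; rewrite mxE.
have := H (fun i => v 0 (inord i)) _ i; rewrite inord_val; apply; last first.
  by rewrite -ltnS ltn_ord.
move=> k kn; rewrite big_mkord.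
move/rowP/(_ (inord k)): vA; rewrite !mxE => e; rewrite -[RHS]e.
apply: eq_bigr => j _; rewrite inord_val !mxE inordK//.
Qed.

Section Initial.
Variables (n : nat) (A : 'M[int]_n.+1).

Definition good_start (y : nat -> 'rV[int]_n.+1) : Prop :=
  let B k l := `|bil (A + A^T) (y k) (y l)| in
  [/\ forall k, (k <= n)%N -> bil A (y k) (y k) = 1,
      forall l k, (l < k <= n)%N -> 3 <= B k l,
      forall l k, (l < k < n)%N -> B k l <= B k.+1 l &
      \det (\matrix_(k < n.+1) y k) != 0].
End Initial.

(** * Starting vectors for the form with hyperbolic part t_0 t_1 *)

Section HypStart.
Variables (n : nat) (a : nat -> int).
Hypothesis n2 : (2 <= n)%N.

Definition hyp_mx : 'M[int]_n.+1 :=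
  delta_mx ord0 (inord 1) +
  diag_mx (\row_(i < n.+1) if (i < 2)%N then 0 else - a i).

Lemma bil_hyp_mx (F G : nat -> int) :
  bil hyp_mx (\row_i F i) (\row_i G i)
  = F 0%N * G 1%N - \sum_(2 <= i < n.+1) a i * (F i * G i).
Proof.
rewrite /hyp_mx bil_addmx bil_delta bil_diag !mxE inordK; last by lia.
congr (_ + _).
transitivity (\sum_(0 <= i < n.+1) F i * (if (i < 2)%N then 0 else - a i) * G i).
  by rewrite big_mkord; apply: eq_bigr => i _; rewrite !mxE.
rewrite big_ltn// big_ltn; last by lia.
rewrite /= !mulr0 !mul0r !add0r -sumrN; apply: eq_big_nat => i /andP[i2 _].
by rewrite ltnNge i2 /=; ring.
Qed.

(** The point (1 + Q(s), 1, s) with Q(s) the sum of the a_i s_i^2 and s = m e_2, plus e_k when k >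
    2. The parameter m makes the values of b large; the extra e_k gives linear independence. *)
Definition hyp_pt (k m i : nat) : int :=
  match i with
  | 0 => 1 + a 2%N * m%:Z ^+ 2 + (if (2 < k)%N then a k else 0)
  | 1 => 1
  | 2 => m%:Z
  | _ => if i == k then 1 else 0
  end.

Lemma hyp_pt_sum (c : nat -> int) (k m : nat) : (k <= n)%N ->
  \sum_(2 <= i < n.+1) c i * hyp_pt k m i
  = c 2%N * m%:Z + (if (2 < k)%N then c k else 0).
Proof.
move=> kn; rewrite big_ltn//=; congr (_ + _).
transitivity (\sum_(3 <= i < n.+1 | i == k) c i).
  rewrite [RHS]big_mkcond; apply: eq_big_nat => -[|[|[|i]]] // _ /=.
  by case: eqP => _; rewrite ?mulr1 ?mulr0.
by rewrite big_nat1_eq ltnS kn andbT.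
Qed.

(** The value is 2 + Q(s - s'), which is large once m is far from m', because a_2 is nonzero. *)
Lemma hyp_pt_polar k m l m' : (l < k <= n)%N ->
  bil (hyp_mx + hyp_mx^T) (\row_i hyp_pt k m i) (\row_i hyp_pt l m' i)
  = 2 + a 2%N * (m%:Z - m'%:Z) ^+ 2 + (if (2 < k)%N then a k else 0)
    + (if (2 < l)%N then a l else 0).
Proof.
move=> lk; rewrite bil_addmx bil_tr !bil_hyp_mx.
under [X in _ + (_ - X)]eq_bigr => i _ do rewrite [hyp_pt l m' i * _]mulrC.
have -> : \sum_(2 <= i < n.+1) a i * (hyp_pt k m i * hyp_pt l m' i)
     = a 2%N * m%:Z * m'%:Z.
  under eq_bigr => i _ do rewrite mulrA.
  rewrite hyp_pt_sum /=; last by lia.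
  case: l lk => [|[|[|l]]] lk; rewrite /= ?addr0// ifF; last by lia.
  by rewrite mulr0 addr0.
by rewrite /=; ring.
Qed.

Lemma hyp_pt_norm k m : (k <= n)%N ->
  bil hyp_mx (\row_i hyp_pt k m i) (\row_i hyp_pt k m i) = 1.
Proof.
move=> kn; rewrite bil_hyp_mx.
under eq_bigr => i _ do rewrite mulrA.
rewrite hyp_pt_sum //=; case: ifP => k2; last by ring.
by case: k k2 kn => [|[|[|k]]] //= _ _; rewrite eqxx; ring.
Qed.

Lemma hyp_start : a 2%N != 0 -> exists y, good_start hyp_mx y.
Proof.
move=> a2.
pose G k m k' m' := bil (hyp_mx + hyp_mx^T) (\row_(i < n.+1) hyp_pt k m i)
  (\row_(i < n.+1) hyp_pt k' m' i).
have [k k' m' K kk|m [m1 m2]] := @increasing_params G n.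
  rewrite /G; pose e := (if (2 < k)%N then a k else 0)
    + (if (2 < k')%N then a k' else 0).
  exists (m' + `|K| + `|(2 + e)%R| + 1)%N => m mM; rewrite hyp_pt_polar//.
  rewrite -addrA -/e; set d := m%:Z - m'%:Z.
  have d1 : `|K| + `|2 + e| + 1 <= d by rewrite /d; lia.
  have d2 : d <= `|a 2%N * d ^+ 2|.
    rewrite normrM (ger0_norm (sqr_ge0 d)).
    have : 1 <= `|a 2%N| by move: a2; lia.
    move=> b1; apply: (@le_trans _ _ (d ^+ 2)); last by rewrite ler_peMl ?sqr_ge0.
    by rewrite expr2 ler_peMl; lia.
  by move: d1 d2; move: (a 2%N * _) => b; lia.
exists (fun k => \row_i hyp_pt k (m k) i); split.
- by move=> k kn; rewrite hyp_pt_norm.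
- by move=> l k lk; have [] := m1 l k lk.
- by move=> l k lk; apply: m2.
apply: (@det_row_fun_neq0 n (fun k i => hyp_pt k (m k) i)) => c H.
have H' k : (k <= n)%N -> c 0%N * (1 + a 2%N * (m k)%:Z ^+ 2
     + (if (2 < k)%N then a k else 0)) + c 1%N + c 2%N * (m k)%:Z
     + (if (2 < k)%N then c k else 0) = 0.
  move=> kn; rewrite -[RHS](H k kn) big_ltn// big_ltn; last by lia.
  by rewrite hyp_pt_sum//= mulr1 !addrA.
have m01 : (m 0%N < m 1%N)%N by apply: (m1 0%N 1%N _).1; lia.
have m12 : (m 1%N < m 2%N)%N by apply: (m1 1%N 2%N _).1; lia.
have h0 := H' 0%N ltac:(lia); have h1 := H' 1%N ltac:(lia).
have h2 := H' 2%N ltac:(lia); rewrite /= !addr0 in h0 h1 h2.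
(* Divided differences: the polynomial c_0 (1 + a_2 m^2) + c_1 + c_2 m of degree at most 2 vanishes
   at the three distinct parameters m_0 < m_1 < m_2, hence is zero. *)
have e1 : a 2%N * c 0%N * ((m 0%N)%:Z + (m 1%N)%:Z) + c 2%N = 0.
  apply: (@mulfI _ ((m 1%N)%:Z - (m 0%N)%:Z)); first by rewrite subr_eq0; lia.
  by rewrite mulr0 -[RHS](subrr 0) -{1}h1 -h0; ring.
have e2 : a 2%N * c 0%N * ((m 1%N)%:Z + (m 2%N)%:Z) + c 2%N = 0.
  apply: (@mulfI _ ((m 2%N)%:Z - (m 1%N)%:Z)); first by rewrite subr_eq0; lia.
  by rewrite mulr0 -[RHS](subrr 0) -{1}h2 -h1; ring.
have c0 : c 0%N = 0.
  apply: (@mulfI _ (a 2%N * ((m 2%N)%:Z - (m 0%N)%:Z))).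
    by rewrite mulf_neq0// subr_eq0; lia.
  by rewrite mulr0 -[RHS](subrr 0) -{1}e2 -e1; ring.
have c2 : c 2%N = 0 by move: e1; rewrite c0; lia.
have c1 : c 1%N = 0 by move: h0; rewrite c0 c2; lia.
case=> [|[|[|i]]] // iN; have := H' _ iN.
by rewrite c0 c1 c2 /=; lia.
Qed.
End HypStart.

(** * Starting vectors for the diagonal form *)

Lemma mul_coprime_sqr (x y z : nat) :
  (0 < x)%N -> coprime x y -> (x * y = z ^ 2)%N -> (x = gcdn x z ^ 2)%N.
Proof.
move=> x0 /eqP co e.
have g0 : (0 < gcdn x z)%N by rewrite gcdn_gt0 x0.
have := dvdn_gcdl x z; have := dvdn_gcdr x z; set g := gcdn x z in g0 *.
move=> /dvdnP[z' ze] /dvdnP[x' xe].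
have co' : coprime x' z'.
  by rewrite /coprime -(eqn_pmul2r g0) muln_gcdl -xe -ze mul1n.
transitivity (gcdn (x ^ 2) (z ^ 2)).
  by rewrite -e -mulnn -muln_gcdr co muln1.
rewrite {1}xe ze !expnMn -muln_gcdl.
have /eqP-> : coprime (x' ^ 2) (z' ^ 2) by rewrite coprimeXl// coprimeXr.
by rewrite mul1n.
Qed.

Section DiagStart.
Variables (n : nat) (a : nat -> int).
Hypothesis n2 : (2 <= n)%N.
Hypothesis a1_gt0 : 0 < a 1%N.
Hypothesis a1_nsq : ~ exists k : int, a 1%N = k ^+ 2.

Definition diag_form_mx : 'M[int]_n.+1 :=
  diag_mx (\row_(i < n.+1) if (i == 0 :> nat) then 1 else - a i).

Lemma bil_diag_form_mx (F G : nat -> int) :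
  bil diag_form_mx (\row_i F i) (\row_i G i)
  = F 0%N * G 0%N - \sum_(1 <= i < n.+1) a i * (F i * G i).
Proof.
rewrite /diag_form_mx bil_diag.
transitivity (\sum_(0 <= i < n.+1) F i * (if i == 0 :> nat then 1 else - a i) * G i).
  by rewrite big_mkord; apply: eq_bigr => i _; rewrite !mxE.
rewrite big_ltn// -sumrN mulr1; congr (_ + _); apply: eq_big_nat => -[|i] // _ /=.
by ring.
Qed.

(* Setting [(u, s) = v (c, a_1)] turns the equation into Pell's equation with
   multiplier [a_1 (c^2 + a_1 b)], whose two factors are coprime, so that it is
   not a square. *)
Lemma diag_seed (b : int) :
  exists t u s : int, [/\ 0 < t, 0 <= u, s != 0 &
    t ^+ 2 - a 1%N * u ^+ 2 - b * s ^+ 2 = 1].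
Proof.
(* As c is 1 modulo p, so is r, whence coprimality; the summand p |b| makes r positive whatever the
   sign of b. *)
pose p := a 1%N; pose c := 1 + p * `|b|; pose r := c ^+ 2 + p * b.
have p0 : 0 < p by [].
have r0 : 0 < r.
  have : 0 <= p * `|b| + p * b by rewrite -mulrDr mulr_ge0 ?(ltW p0)//; lia.
  have : 0 <= p * `|b| by rewrite mulr_ge0// ltW.
  rewrite /r /c; move: (p * `|b|) (p * b) => x y x0 xy.
  have -> : (1 + x) ^+ 2 + y = 1 + (x + (x ^+ 2 + (x + y))) by ring.
  by rewrite ltr_wpDr// addr_ge0// addr_ge0// sqr_ge0.
have [] := @pell_solution (p * r); [|by rewrite mulr_gt0|].
  case=> k e; apply: a1_nsq.
  have co : coprimez p r.
    apply/coprimezP; exists (- (`|b| *+ 2 + p * `|b| ^+ 2 + b), 1) => /=.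
    by rewrite /r /c; ring.
  exists (gcdz p k); rewrite -/p.
  have /mul_coprime_sqr : coprime `|p| `|r| by [].
  move=> /(_ `|k|%N); rewrite absz_gt0 gt_eqF// -abszM e abszX => /(_ isT erefl) e'.
  by rewrite -[LHS](gtz0_abs a1_gt0) -/p {1}e' /gcdz expr2 -PoszM mulnn.
move=> t [v [t0 v0 e]]; exists t, (v * c), (v * p); split=> //.
- apply: mulr_ge0; first exact: ltW.
  by rewrite /c addr_ge0// mulr_ge0// ltW.
- by rewrite mulf_neq0// gt_eqF.
- by rewrite -[RHS]e /r; ring.
Qed.

Section Orbit.
Variables (x v : int).
Hypotheses (x_gt0 : 0 < x) (v_gt0 : 0 < v).
Hypothesis pell : x ^+ 2 - a 1%N * v ^+ 2 = 1.

(** Multiplication of w.1 + w.2 sqrt(a_1) by the unit x + v sqrt(a_1). *)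
Definition pell_act (w : int * int) : int * int :=
  (x * w.1 + a 1%N * v * w.2, v * w.1 + x * w.2).

Lemma pell_act_norm w m :
  (iter m pell_act w).1 ^+ 2 - a 1%N * (iter m pell_act w).2 ^+ 2
  = w.1 ^+ 2 - a 1%N * w.2 ^+ 2.
Proof.
elim: m => //= m <-; case: (iter m _ _) => t u /=.
by rewrite -[RHS]mul1r -pell; ring.
Qed.

Lemma pell_act_pos w m : 0 < w.1 -> 0 <= w.2 ->
  0 < (iter m pell_act w).1 /\ 0 <= (iter m pell_act w).2.
Proof.
move=> t0 u0; elim: m => //= m []; case: (iter m _ _) => t u /= t1 u1.
split; first by rewrite ltr_wpDr ?mulr_gt0// !mulr_ge0// ltW.
by rewrite addr_ge0// mulr_ge0// ltW.
Qed.

Lemma pell_act_incr w m : 0 < w.1 -> 0 <= w.2 ->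
  (iter m pell_act w).2 < (iter m.+1 pell_act w).2.
Proof.
move=> t0 u0; have [] := pell_act_pos m t0 u0.
by rewrite iterS; case: (iter m _ _) => t u /=; nia.
Qed.

Lemma pell_act_lt w i j : 0 < w.1 -> 0 <= w.2 -> (i < j)%N ->
  (iter i pell_act w).2 < (iter j pell_act w).2.
Proof.
move=> t0 u0; elim: j => // j IH; rewrite ltnS leq_eqVlt => /orP[/eqP->|/IH h].
  exact: pell_act_incr.
by apply: lt_trans h _; apply: pell_act_incr.
Qed.

Lemma pell_act_ge w m : 0 < w.1 -> 0 <= w.2 -> m%:Z <= (iter m pell_act w).2.
Proof.
move=> t0 u0; elim: m => // m IH.
by have := pell_act_incr m t0 u0; lia.
Qed.

(** The difference F = t y0 - a_1 u y1 might suffer cancellation, so it is multiplied by the sum H =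
    t y0 + a_1 u y1. The product is a_1 u^2 (y0^2 - a_1 y1^2) up to a constant, hence of order u^2,
    while H is of order u. *)
Lemma pell_act_growth w (y0 y1 K : int) : 0 < w.1 -> 0 <= w.2 ->
  0 < y0 -> 0 <= y1 ->
  exists M, forall m, (M <= m)%N ->
   K <= `|2 * ((iter m pell_act w).1 * y0 - a 1%N * (iter m pell_act w).2 * y1)|.
Proof.
move=> w1 w2 y00 y10; pose N := w.1 ^+ 2 - a 1%N * w.2 ^+ 2.
(* Chosen so that H <= C u, using t <= (|N| + a_1) u, which follows from t^2 = N + a_1 u^2 once u >=
   1. *)
pose C := (`|N| + a 1%N) * y0 + a 1%N * y1.
exists `|(`|K| * C + `|N| * y0 ^+ 2 + 1)%R|%N => m mM.
have [] := pell_act_pos m w1 w2; have := pell_act_ge m w1 w2.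
have := pell_act_norm w m; rewrite -/N.
case: (iter m _ _) => t u /= e um t1 u1.
have um' : `|K| * C + `|N| * y0 ^+ 2 + 1 <= u by lia.
have C0 : 0 < C.
  rewrite ltr_wpDr ?mulr_ge0// ?ltW// mulr_gt0//.
  by rewrite ltr_wpDl.
have N0 : 0 <= `|N| * y0 ^+ 2 by rewrite mulr_ge0// sqr_ge0.
have KC0 : 0 <= `|K| * C by rewrite mulr_ge0// ltW.
have u0 : 0 < u by lia.
have tu : t <= (`|N| + a 1%N) * u.
  have q1 : 1 <= `|N| + a 1%N by lia.
  rewrite -ler_sqr ?nnegrE ?mulr_ge0//; [|by lia|by lia].
  have -> : t ^+ 2 = N + a 1%N * u ^+ 2 by rewrite -e; ring.
  have h1 : N + a 1%N * u ^+ 2 <= (`|N| + a 1%N) * u ^+ 2.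
    rewrite mulrDl lerD2r; apply: le_trans (ler_norm N) _.
    by rewrite ler_peMr// expr2; nia.
  apply: le_trans h1 _; rewrite exprMn ler_wpM2r ?sqr_ge0//.
  by rewrite expr2 ler_peMl//; lia.
set F := t * y0 - a 1%N * u * y1; set H := t * y0 + a 1%N * u * y1.
have H0 : 0 <= H <= C * u.
  apply/andP; split.
    by rewrite addr_ge0// !mulr_ge0// ltW.
  rewrite /H /C mulrDl lerD//; last by rewrite mulrAC.
  by rewrite mulrAC ler_wpM2r// ltW.
have FH : F * H = N * y0 ^+ 2 + a 1%N * u ^+ 2 * (y0 ^+ 2 - a 1%N * y1 ^+ 2).
  by rewrite /F /H -e; ring.
(* A nonzero integer, because a_1 is not a square. *)
have z0 : 1 <= `|y0 ^+ 2 - a 1%N * y1 ^+ 2|.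
  rewrite -gtz0_ge1 normr_gt0 subr_eq0; apply/eqP => e0.
  have [y1e|y1n] := eqVneq y1 0.
    by move: e0; rewrite y1e expr0n mulr0 => /eqP; rewrite sqrf_eq0; lia.
  by apply: a1_nsq; apply: sqr_quotient_is_sqr e0.
have FHn : u ^+ 2 - `|N| * y0 ^+ 2 <= `|F| * H.
  rewrite -[H]ger0_norm; last by case/andP: H0.
  rewrite -normrM FH -[in `|N| * _](ger0_norm (sqr_ge0 y0)) -normrM.
  have : u ^+ 2 <= `|a 1%N * u ^+ 2 * (y0 ^+ 2 - a 1%N * y1 ^+ 2)|.
    rewrite normrM; apply: (@le_trans _ _ `|a 1%N * u ^+ 2|); last by rewrite ler_peMr.
    rewrite normrM (ger0_norm (sqr_ge0 u)) ler_peMl ?sqr_ge0//; lia.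
  have := ler_normB (N * y0 ^+ 2 + a 1%N * u ^+ 2 * (y0 ^+ 2 - a 1%N * y1 ^+ 2)) (N * y0 ^+ 2).
  by rewrite [in X in X -> _]addrAC subrr add0r lerBlDr => h1 h2; apply: le_trans h2 h1.
have FC : u - `|N| * y0 ^+ 2 <= `|F| * C.
  rewrite -(ler_pM2r u0); apply: le_trans (_ : `|F| * H <= _); last first.
    by rewrite -mulrA ler_wpM2l//; case/andP: H0.
  apply: le_trans FHn; rewrite mulrBl -expr2 lerD2l lerN2 ler_peMr//; lia.
have KF : `|K| <= `|F|.
  rewrite -(ler_pM2r C0); apply: le_trans FC; lia.
by rewrite normrM; lia.
Qed.

End Orbit.

Lemma diag_start : exists y, good_start diag_form_mx y.
Proof.
have [x [v [x0 v0 pell]]] := pell_solution a1_nsq a1_gt0.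
(* Indices 0 and 1 share the seed (1, 0, 0) and will differ by their exponents in the Pell orbit; an
   index k >= 2 has a seed with nonzero k-th coordinate. *)
have /choice[f fP] : forall k : nat, exists f : int * int * int,
    if (k < 2)%N then f = (1, 0, 0) else
    [/\ 0 < f.1.1, 0 <= f.1.2, f.2 != 0 &
        f.1.1 ^+ 2 - a 1%N * f.1.2 ^+ 2 - a k * f.2 ^+ 2 = 1].
  move=> k; case: (ltnP k 2) => k2; first by exists (1, 0, 0).
  have [t [u [s [t0 u0 s0 e]]]] := diag_seed (a k).
  by exists (t, u, s).
pose w k m := iter m (pell_act x v) (f k).1.
have fpos k : 0 < (f k).1.1 /\ 0 <= (f k).1.2.
  by have := fP k; case: ifP => [_ ->//|_ []].
pose F k m i : int := match i with
  | 0 => (w k m).1 | 1 => (w k m).2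
  | _ => if i == k then (f k).2 else 0 end.
have Fsum (c : nat -> int) k m : (k <= n)%N ->
    \sum_(2 <= i < n.+1) c i * F k m i = if (2 <= k)%N then c k * (f k).2 else 0.
  move=> kn; transitivity (\sum_(2 <= i < n.+1 | i == k) c i * (f k).2).
    rewrite [RHS]big_mkcond; apply: eq_big_nat => -[|[|i]] // _ /=.
    by case: eqP => _; rewrite ?mulr0.
  by rewrite big_nat1_eq ltnS kn andbT.
have pos k m : 0 < (w k m).1 /\ 0 <= (w k m).2.
  by have [f1 f2] := fpos k; apply: pell_act_pos.
have norm k m : (k <= n)%N ->
    bil diag_form_mx (\row_i F k m i) (\row_i F k m i) = 1.
  move=> kn; rewrite bil_diag_form_mx big_ltn; last by lia.
  under eq_bigr => i _ do rewrite mulrA.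
  rewrite Fsum // opprD addrA.
  have e2 := pell_act_norm pell (f k).1 m; rewrite -/(w k m) in e2.
  rewrite (_ : F k m 0%N * F k m 0%N - _ = (f k).1.1 ^+ 2 - a 1%N * (f k).1.2 ^+ 2);
    last by rewrite -e2.
  have := fP k; rewrite ltnNge; case: (leqP 2 k) => /= k2.
    move=> [_ _ _ <-]; congr (_ - _).
    by case: k k2 {kn e2} => [|[|k]] //= _; rewrite eqxx expr2 mulrA.
  by move=> -> /=; ring.
(* For distinct indices the coordinates beyond the first two have disjoint supports, so only the
   Pell plane contributes. *)
have polarE k m l m' : (l < k <= n)%N ->
    bil (diag_form_mx + diag_form_mx^T) (\row_i F k m i) (\row_i F l m' i)
    = 2 * ((w k m).1 * (w l m').1 - a 1%N * (w k m).2 * (w l m').2).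
  move=> lk; rewrite bil_addmx bil_tr !bil_diag_form_mx.
  under [X in _ + (_ - X)]eq_bigr => i _ do rewrite [F l m' i * _]mulrC.
  have -> : \sum_(1 <= i < n.+1) a i * (F k m i * F l m' i)
     = a 1%N * (w k m).2 * (w l m').2.
    rewrite big_ltn; last by lia.
    under eq_bigr => i _ do rewrite mulrA.
    rewrite Fsum; last by lia.
    rewrite mulrA; case: l lk => [|[|l]] lk; rewrite /= ?addr0//.
    case: k lk => [|[|k]] // lk /=; rewrite ifF; last by lia.
    by rewrite mulr0 mul0r addr0.
  by rewrite /=; ring.
pose G k m k' m' := bil (diag_form_mx + diag_form_mx^T)
  (\row_(i < n.+1) F k m i) (\row_(i < n.+1) F k' m' i).
have [k k' m' K kk|m [m1 m2]] := @increasing_params G n.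
  have [f1 f2] := fpos k; have [w1 w2] := pos k' m'.
  have [M MP] := pell_act_growth x0 v0 pell K f1 f2 w1 w2.
  by exists M => m mM; rewrite /G polarE//; apply: MP.
exists (fun k => \row_i F k (m k) i); split.
- by move=> k kn; rewrite norm.
- by move=> l k lk; have [] := m1 l k lk.
- by move=> l k lk; apply: m2.
apply: (@det_row_fun_neq0 n (fun k i => F k (m k) i)) => c H.
have H' k : (k <= n)%N -> c 0%N * (w k (m k)).1 + c 1%N * (w k (m k)).2
     + (if (2 <= k)%N then c k * (f k).2 else 0) = 0.
  move=> kn; rewrite -[RHS](H k kn) big_ltn// big_ltn; last by lia.
  by rewrite Fsum//= !addrA.
have m01 : (m 0%N < m 1%N)%N by apply: (m1 0%N 1%N _).1; lia.
have [h0 h1] := (H' 0%N ltac:(lia), H' 1%N ltac:(lia)).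
rewrite /= !addr0 in h0 h1.
have [t0 u0] := pos 0%N (m 0%N); have [t1 u1] := pos 1%N (m 1%N).
have n0 := pell_act_norm pell (f 0%N).1 (m 0%N).
have n1 := pell_act_norm pell (f 1%N).1 (m 1%N).
have ult : (w 0%N (m 0%N)).2 < (w 1%N (m 1%N)).2.
  rewrite /w (fP 1%N) -(fP 0%N); have [f1 f2] := fpos 0%N.
  exact: pell_act_lt.
rewrite -/(w 0%N (m 0%N)) (fP 0%N) in n0; rewrite -/(w 1%N (m 1%N)) (fP 1%N) in n1.
move: h0 h1 t0 u0 t1 u1 n0 n1 ult.
case: (w 0%N _) (w 1%N _) => t u [t' u'] /= h0 h1 t0 u0 t1 u1 n0 n1 ult.
(* Two proportional points on the conic t^2 - a_1 u^2 = 1 have the same u^2, whereas 0 <= u < u'. *)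
have det0 : t * u' - t' * u != 0.
  apply/eqP => /eqP; rewrite subr_eq0 => /eqP e.
  have : u' ^+ 2 = u ^+ 2.
    have : (t * u') ^+ 2 = (t' * u) ^+ 2 by rewrite e.
    rewrite !exprMn.
    have -> : t ^+ 2 = 1 + a 1%N * u ^+ 2 by move: n0; lia.
    have -> : t' ^+ 2 = 1 + a 1%N * u' ^+ 2 by move: n1; lia.
    move=> e3; apply: (@addIr _ (a 1%N * u ^+ 2 * u' ^+ 2)).
    transitivity ((1 + a 1%N * u ^+ 2) * u' ^+ 2); first by ring.
    by rewrite e3; ring.
  by rewrite !expr2; move: ult u0; clear; nia.
have c0 : c 0%N = 0.
  apply: (mulIf det0); rewrite mul0r.
  transitivity ((c 0%N * t + c 1%N * u) * u' - (c 0%N * t' + c 1%N * u') * u).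
    by ring.
  by rewrite h0 h1 !mul0r subrr.
have c1 : c 1%N = 0.
  move: h1; rewrite c0 mul0r add0r => /eqP; rewrite mulf_eq0 => /orP[/eqP//|].
  by move=> /eqP u'0; move: ult u0; rewrite u'0; lia.
case=> [|[|i]] // iN; have := H' _ iN; have [_ _ fi _] := fP i.+2.
rewrite c0 c1 !mul0r !add0r /= => /eqP; rewrite mulf_eq0 (negPf fi) orbF.
by move/eqP.
Qed.
End DiagStart.

(** * The integral orbit *)

Section Bilinear.
Variables (K : comPzRingType) (m : nat) (S : 'M[K]_m).

Lemma bilDl x y z : bil S (x + y) z = bil S x z + bil S y z.
Proof. by rewrite /bil !mulmxDl mxE. Qed.

Lemma bilZl c x z : bil S (c *: x) z = c * bil S x z.
Proof. by rewrite /bil -!scalemxAl mxE. Qed.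

Lemma bilNl x z : bil S (- x) z = - bil S x z.
Proof. by rewrite -scaleN1r bilZl mulN1r. Qed.

Lemma bilBl x y z : bil S (x - y) z = bil S x z - bil S y z.
Proof. by rewrite bilDl bilNl. Qed.

Lemma bilDr x y z : bil S x (y + z) = bil S x y + bil S x z.
Proof. by rewrite -![bil S x _]bil_tr /bil !mulmxDl mxE. Qed.

Lemma bilZr c x z : bil S x (c *: z) = c * bil S x z.
Proof. by rewrite -![bil S x _]bil_tr /bil -!scalemxAl mxE. Qed.

Lemma bil_sym x y : bil (S + S^T) x y = bil (S + S^T) y x.
Proof. by rewrite !bil_addmx !bil_tr addrC. Qed.

Lemma bil_sym_diag x : bil (S + S^T) x x = bil S x x *+ 2.
Proof. by rewrite bil_addmx bil_tr mulr2n. Qed.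

(** As q(x) = 1, z is the opposite of the reflection of y along x, and reflections are
    isometries. *)
Lemma bil_reflection x y : bil S x x = 1 -> bil S y y = 1 ->
  let z := bil (S + S^T) x y *: x - y in bil S z z = 1.
Proof.
move=> x1 y1; rewrite bil_addmx bil_tr /= bilBl bilZl -!scaleN1r !bilDr !bilZr.
by rewrite x1 y1; ring.
Qed.

End Bilinear.

Lemma dvdz_det_mull n (M M' P : 'M[int]_n) : M' = P *m M -> (\det M %| \det M')%Z.
Proof. by move=> ->; rewrite det_mulmx dvdz_mull. Qed.

(** The threshold 3 is exactly what yields doubling: (|x| - 1) |z| and |x| (|z| - 1) are both at
    least 2 |z|. *)
Lemma mul_sub_max (x z d : int) : 3 <= `|x| -> 3 <= `|z| ->
  `|d| <= Num.max `|x| `|z| -> 2 * `|z| <= `|x * z - d|.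
Proof.
move=> x3 z3 dm; apply: le_trans (lerB_dist _ _); rewrite normrM.
move: dm; rewrite le_max; move: (`|x|) (`|z|) (`|d|) x3 z3 => X Z D X3 Z3.
by move=> /orP[] h; nia.
Qed.

Section Orbit.
Variables (n : nat) (A : 'M[int]_n.+1) (y : nat -> 'rV[int]_n.+1).
Hypothesis n2 : (2 <= n)%N.
Hypothesis y_start : good_start A y.

Let b := bil (A + A^T).

(** The recursion reaches back n + 1 steps, so it is iterated on windows of vectors; entries of
    index greater than n carry no meaning. *)
Definition orbit_step (z : nat -> 'rV[int]_n.+1) (k : nat) :=
  if (k < n)%N then z k.+1 else b (z n) (z 0%N) *: z n - z 0%N.

Definition orbit i := iter i orbit_step y 0%N.

Lemma orbit_window i k : (k <= n)%N -> iter i orbit_step y k = orbit (i + k).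
Proof.
elim: k i => [|k IH] i kn; first by rewrite addn0.
have := IH i.+1 (ltnW kn); rewrite iterS {1}/orbit_step kn => ->.
by rewrite addSnnS.
Qed.

Lemma orbit_init k : (k <= n)%N -> orbit k = y k.
Proof. by move=> kn; rewrite -(orbit_window 0). Qed.

Let B k l := b (orbit k) (orbit l).

Lemma orbitS i :
  orbit (i + n.+1) = B (i + n) i *: orbit (i + n) - orbit i.
Proof.
rewrite addnS -addSn -(orbit_window i.+1)// iterS /orbit_step ltnn.
by rewrite !orbit_window// addn0.
Qed.

Lemma orbit_norm i : bil A (orbit i) (orbit i) = 1.
Proof.
have [i_le|i_gt] := leqP i n.
  by rewrite orbit_init//; case: y_start => + _ _ _; apply.
elim/ltn_ind: i i_gt => i IH i_gt.
suff norm1 k : (k < i)%N -> bil A (orbit k) (orbit k) = 1.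
  rewrite -(subnK i_gt) orbitS; set j := (i - n.+1)%N.
  by apply: bil_reflection; apply: norm1; rewrite /j; lia.
move=> ki; have [k_le|k_gt] := leqP k n; last exact: IH.
by rewrite orbit_init//; case: y_start => + _ _ _; apply.
Qed.

Lemma orbit_diag i : B i i = 2.
Proof. by rewrite /B /b bil_sym_diag orbit_norm. Qed.

Lemma orbitBC i j : B i j = B j i.
Proof. exact: bil_sym. Qed.

Lemma orbitB_rec i l : B (i + n.+1) l = B (i + n) i * B (i + n) l - B i l.
Proof. by rewrite {1}/B orbitS /b bilBl bilZl. Qed.

(** Since q = 1 makes the diagonal of B equal to 2, the recursion gives 2 c - c. The multiplier of
    each step is thereby a value of B at consecutive indices. *)
Lemma orbitB_next i : B (i + n.+1) (i + n) = B (i + n) i.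
Proof. by rewrite orbitB_rec orbit_diag [B i (i + n)]orbitBC; ring. Qed.

Let inv j := (forall l k, (l < k <= j)%N -> 3 <= `|B k l|) /\
  (forall l k, (l < k < j)%N -> `|B k l| <= `|B k.+1 l|).

Lemma inv_mono j l k k' : inv j -> (l < k)%N -> (k <= k' <= j)%N ->
  `|B k l| <= `|B k' l|.
Proof.
move=> [_ H] lk; elim: k' => [|k' IH] h; first by have -> : k = 0%N by lia.
have [->|kk] := eqVneq k k'.+1; first by [].
by apply: le_trans (IH _) (H _ _ _); lia.
Qed.

(** The term subtracted in the recursion for B is dominated by one of the two factors of the main
    term: by monotonicity in the larger index if l < i, and after exchanging the arguments if l >
    i. *)
Lemma inv_past i l : inv (i + n) -> (l < i + n)%N ->
  `|B i l| <= Num.max `|B (i + n) i| `|B (i + n) l|.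
Proof.
move=> Ij li; rewrite le_max; have [lt|gt|->] := ltngtP l i.
- by rewrite (inv_mono Ij lt) ?orbT//; lia.
- by rewrite orbitBC (inv_mono Ij gt)//; lia.
- by rewrite orbit_diag; case: Ij => /(_ i (i + n)%N) + _; lia.
Qed.

Lemma invS i : inv (i + n) -> inv (i + n.+1).
Proof.
move=> Ij; have [I1 I2] := Ij.
have key l : (l < i + n)%N -> 2 * `|B (i + n) l| <= `|B (i + n.+1) l|.
  move=> li; rewrite orbitB_rec; apply: mul_sub_max.
  - by apply: I1; lia.
  - by apply: I1; lia.
  - exact: inv_past.
have last3 : 3 <= `|B (i + n.+1) (i + n)| by rewrite orbitB_next I1//; lia.
split=> l k h.
  have [->|kn] := eqVneq k (i + n.+1)%N; last by apply: I1; lia.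
  have [->|ln] := eqVneq l (i + n)%N; first by [].
  have := key l ltac:(lia); have := I1 l (i + n)%N; lia.
have [kn|kn] := eqVneq k (i + n)%N; last by apply: I2; lia.
rewrite kn -addnS; have := key l ltac:(lia); lia.
Qed.

Lemma inv_all i : inv (i + n).
Proof.
elim: i => [|i IH]; last by rewrite addSnnS; exact: invS.
case: y_start => _ s1 s2 _; split=> l k h.
  by rewrite /B !orbit_init; [apply: s1|lia..].
by rewrite /B !orbit_init; [apply: s2|lia..].
Qed.

Definition window i : 'M[int]_n.+1 := \matrix_(k < n.+1) orbit (i + k).

(** The recursion can be solved for its oldest vector as well as for its newest, so consecutive
    windows are integral combinations of each other and their determinants divide each other. *)
Lemma det_window i : `|\det (window i)| = `|\det (window 0)|.
Proof.
elim: i => [//|i <-].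
suff [d1 d2] : (\det (window i.+1) %| \det (window i))%Z /\
               (\det (window i) %| \det (window i.+1))%Z.
  by apply/eqP; rewrite -!abszE eqz_nat eqn_dvd; apply/andP.
split.
- pose P : 'M[int]_n.+1 := \matrix_(k < n.+1) (if k == 0 :> nat then
     B (i + n) i *: delta_mx 0 (inord n.-1) - delta_mx 0 (inord n)
     else delta_mx 0 (inord k.-1)).
  apply: (@dvdz_det_mull _ _ _ P); apply/row_matrixP => k.
  rewrite row_mul !rowK; case: eqP => [k0|k0].
    rewrite mulmxBl -scalemxAl -!rowE !rowK !inordK; [|lia..].
    rewrite k0 addn0 !addSnnS prednK; last by lia.
    by rewrite orbitS opprB addrC subrK.
  have := ltn_ord k => kn; rewrite -rowE rowK inordK; last by lia.
  by rewrite addSnnS prednK//; lia.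
- pose P : 'M[int]_n.+1 := \matrix_(k < n.+1) (if k == n :> nat then
     B (i + n) i *: delta_mx 0 (inord n) - delta_mx 0 (inord 0)
     else delta_mx 0 (inord k.+1)).
  apply: (@dvdz_det_mull _ _ _ P); apply/row_matrixP => k.
  have kn := ltn_ord k.
  rewrite row_mul !rowK; case: eqP => [k0|k0].
    rewrite mulmxBl -scalemxAl -!rowE !rowK !inordK; [|lia..].
    by rewrite k0 addn0 addSnnS orbitS.
  by rewrite -rowE rowK inordK; [rewrite addSnnS|lia].
Qed.

End Orbit.

Section GrowingOrbit.
Variables (n : nat) (A : 'M[int]_n.+1).

(* The quantity [B j.+1 j] is the multiplier in the recursion for [z j.+1]. *)
Definition growing_orbit (z : nat -> 'rV[int]_n.+1) : Prop :=
  let B k l := bil (A + A^T) (z k) (z l) in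
  [/\ forall i, z (i + n.+1)%N = B (i + n)%N i *: z (i + n)%N - z i,
      forall i, bil A (z i) (z i) = 1,
      forall i, `|\det (\matrix_(k < n.+1) z (i + k)%N)|
                = `|\det (\matrix_(k < n.+1) z k)|,
      \det (\matrix_(k < n.+1) z k) != 0 &
      [/\ forall l j, (l < j)%N -> 3 <= `|B j l|,
          forall l j, (l < j)%N -> 2 * `|B j l| <= `|B j.+1 l|,
          forall l j, (l < j)%N ->
            `|B j.+1 l - B j.+1 j * B j l| <= Num.max `|B j.+1 j| `|B j l|,
          forall j, 2 * `|B j.+1 j| <= `|B j.+2 j.+1| &
          forall j, B (j + n)%N j = B (j + n).+1 (j + n)%N]].

Lemma growing_orbit_exists y : (2 <= n)%N -> good_start A y ->
  (* The orbit is read from index n on. Each [z j.+1] is then produced by the recursion, even for j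
     < n, so that the estimates hold for all j without exception. *)
  exists z, growing_orbit z.
Proof.
move=> n2 ys; exists (fun i => orbit A y (i + n)).
have I := inv_all n2 ys.
have rec l j : bil (A + A^T) (orbit A y (j.+1 + n)) (orbit A y l)
  = bil (A + A^T) (orbit A y (j + n)) (orbit A y j)
    * bil (A + A^T) (orbit A y (j + n)) (orbit A y l)
    - bil (A + A^T) (orbit A y j) (orbit A y l).
  by rewrite addSnnS orbitB_rec.
have nxt j : bil (A + A^T) (orbit A y (j.+1 + n)) (orbit A y (j + n))
  = bil (A + A^T) (orbit A y (j + n)) (orbit A y j).
  by rewrite addSnnS orbitB_next.
split.
- by move=> i; rewrite addnAC orbitS// -addnA [(n + n)%N]addnC addnA.
- by move=> i; exact: orbit_norm.
- move=> i; rewrite (_ : \matrix_(k < n.+1) _ = window A y (i + n)); last first.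
    by apply/row_matrixP => k; rewrite !rowK addnAC.
  rewrite (_ : \matrix_(k < n.+1) _ = window A y n) ?det_window//.
  by apply/row_matrixP => k; rewrite !rowK addnC.
- rewrite (_ : \matrix_(k < n.+1) _ = window A y n); last first.
    by apply/row_matrixP => k; rewrite !rowK addnC.
  rewrite -normr_eq0 det_window// normr_eq0; case: ys => _ _ _.
  rewrite (_ : window A y 0 = \matrix_(k < n.+1) y k)//.
  by apply/row_matrixP => k; rewrite !rowK orbit_init// -ltnS ltn_ord.
split.
- by move=> l j lj; have [I1 _] := I j; apply: I1; lia.
- move=> l j lj; have [I1 _] := I j; rewrite rec; apply: mul_sub_max.
  + by apply: I1; lia.
  + by apply: I1; lia.
  + by apply: (inv_past n2 ys (I j)); lia.
- move=> l j lj; rewrite nxt rec addrAC subrr add0r normrN.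
  by apply: (inv_past n2 ys (I j)); lia.
- move=> j; rewrite nxt nxt rec [X in _ <= `|X - _|]mulrC; have [I1 _] := I j.
  rewrite [bil _ (orbit A y j) _]bil_sym.
  apply: mul_sub_max; [by apply: I1; lia..|].
  by rewrite le_max (inv_mono n2 (I j)) ?orbT//; lia.
- by move=> j; rewrite -addSn nxt.
Qed.
End GrowingOrbit.

(** * Growth of the multipliers *)

Section RealLemmas.
Context {R : realType}.

Lemma half_exprS i : 2 ^- i.+1 = 2 ^- i / 2 :> R.
Proof. by rewrite exprSr invfM mulrC. Qed.

Lemma half_expr_gt0 i : 0 < 2 ^- i :> R.
Proof. by rewrite invr_gt0 exprn_gt0. Qed.

Lemma half_expr_ge0 i : 0 <= 2 ^- i :> R.
Proof. exact: ltW (half_expr_gt0 i). Qed.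

(** Accumulates relative errors K 2^{-i}; a bound multiplied by it at each step stays bounded. *)
Definition geo_prod (K : R) j := \prod_(i < j) (1 + K * 2 ^- i).

Lemma geo_prodS (K : R) j : geo_prod K j.+1 = geo_prod K j * (1 + K * 2 ^- j).
Proof. by rewrite /geo_prod big_ord_recr. Qed.

Lemma geo_prod_gt0 (K : R) j : 0 <= K -> 0 < geo_prod K j.
Proof.
move=> K0; apply: prodr_gt0 => i _.
by rewrite ltr_wpDr// mulr_ge0// half_expr_ge0.
Qed.

Lemma geo_prod_ge0 (K : R) j : 0 <= K -> 0 <= geo_prod K j.
Proof. by move=> K0; apply: ltW; apply: geo_prod_gt0. Qed.

Lemma geo_prod_le (K : R) j : 0 <= K -> geo_prod K j <= expR (2 * K).
Proof.
move=> K0; suff h : geo_prod K j <= expR (2 * K * (1 - 2 ^- j)).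
  apply: le_trans h _; rewrite ler_expR; apply: ler_piMr; first by rewrite mulr_ge0.
  by rewrite gerBl half_expr_ge0.
elim: j => [|j IH].
  by rewrite /geo_prod big_ord0 expr0 invr1 subrr mulr0 expR0.
rewrite geo_prodS (_ : 2 * K * _ = 2 * K * (1 - 2 ^- j) + K * 2 ^- j); last first.
  by rewrite half_exprS; field; rewrite expf_neq0.
rewrite expRD; apply: ler_pM; rewrite ?expR_ge1Dx ?geo_prod_ge0//.
by rewrite addr_ge0// mulr_ge0// half_expr_ge0.
Qed.

Lemma geo_prod_leS (K : R) j : 0 <= K -> geo_prod K j <= geo_prod K j.+1.
Proof.
move=> K0; rewrite geo_prodS; apply: ler_peMr; first exact: geo_prod_ge0.
by rewrite lerDl mulr_ge0// half_expr_ge0.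
Qed.

End RealLemmas.

(** * A linear recurrence with characteristic root rho, up to a summable error *)

Section NBonacci.
Context {R : realType}.
Variables (n : nat) (rho : R).
Hypothesis n2 : (2 <= n)%N.
Hypothesis rho_gt0 : 0 < rho.
Hypothesis rho_root : rho ^+ n = \sum_(k < n) rho ^+ k.

(** Multiplying the equation of rho by rho - 1 makes rho a root of x^{n+1} - 2 x^n + 1. *)
Lemma rho_eq : (2 - rho) * rho ^+ n = 1.
Proof.
have := subrX1 rho n; rewrite -rho_root => e.
by rewrite mulrBl mulr2n mulrDl mul1r -{2}[rho ^+ n](subrK 1) e; ring.
Qed.

Lemma rho_lt2 : 0 < 2 - rho.
Proof. by rewrite -(pmulr_lgt0 _ (exprn_gt0 n rho_gt0)) rho_eq. Qed.

Lemma rho_weights : \sum_(k < n) (2 - rho) * rho ^+ k = 1.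
Proof. by rewrite -mulr_sumr -rho_root rho_eq. Qed.

(* [x^{n+1} - 2 x^n + 1] factors as [(x - rho) (x^n - sum_k c_k x^{n-1-k})] with
   nonnegative weights [c_k = (2 - rho) rho^k] of sum 1, so that the sequence
   [L i.+1 - rho * L i] evolves by averaging. *)
Lemma nbonacci_defect_bounded (L : nat -> R) (K : R) : 0 <= K ->
  (forall i, `|L (i + n).+1 - 2 * L (i + n)%N + L i| <= K * 2 ^- i) ->
  exists M, forall i, `|L i.+1 - rho * L i| <= M.
Proof.
move=> K0 HL; pose w i := L i.+1 - rho * L i.
pose M0 := \sum_(i < n) `|w i|.
(* Averaging does not increase the maximum, and 2 K (1 - 2^{-i}) is the sum of the first i errors K
   2^{-k}. *)
suff H i : forall j, (j < i + n)%N -> `|w j| <= M0 + 2 * K * (1 - 2 ^- i).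
  exists (M0 + 2 * K) => i; apply: le_trans (H i.+1 i _) _.
    by rewrite addSn ltnS leq_addr.
  rewrite lerD2l; apply: ler_piMr; first by rewrite mulr_ge0.
  by rewrite gerBl half_expr_ge0.
elim: i => [|i IH] j.
  rewrite add0n expr0 invr1 subrr mulr0 addr0 => jn.
  rewrite /M0 (bigD1 (Ordinal jn))//= lerDl; apply: sumr_ge0 => k _.
  exact: normr_ge0.
have step : M0 + 2 * K * (1 - 2 ^- i.+1) = M0 + 2 * K * (1 - 2 ^- i) + K * 2 ^- i.
  by rewrite half_exprS; field; rewrite expf_neq0.
rewrite addSn ltnS leq_eqVlt => /orP[/eqP->|/IH h]; last first.
  by rewrite step; apply: le_trans h _; rewrite lerDl mulr_ge0// half_expr_ge0.
(* The weighted sum telescopes; at m = n, multiplied by 2 - rho, it is (2 - rho) L_{i+n} - L_i,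
   which differs from w_{i+n} by the defect. *)
have tel m : (m <= n)%N -> \sum_(k < m) rho ^+ k * w (i + n - k.+1)%N
    = L (i + n)%N - rho ^+ m * L (i + n - m)%N.
  elim: m => [|m IHm] mn; first by rewrite big_ord0 expr0 mul1r subn0 subrr.
  rewrite big_ord_recr /= IHm ?(ltnW mn)// /w -subSn; last first.
    by rewrite (leq_trans mn)// leq_addl.
  by rewrite subSS exprS; ring.
have e : w (i + n)%N = \sum_(k < n) (2 - rho) * rho ^+ k * w (i + n - k.+1)%N
    + (L (i + n).+1 - 2 * L (i + n)%N + L i).
  under eq_bigr do rewrite -mulrA.
  rewrite -mulr_sumr tel// addnK mulrBr mulrA rho_eq mul1r /w; ring.
rewrite e step; apply: le_trans (ler_normD _ _) _; apply: lerD => //.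
apply: le_trans (ler_norm_sum _ _ _) _.
rewrite -[leRHS]mul1r -[X in _ <= X * _]rho_weights mulr_suml; apply: ler_sum => k _.
have c0 : 0 <= (2 - rho) * rho ^+ k.
  by rewrite mulr_ge0 ?exprn_ge0 ?(ltW rho_lt2) ?(ltW rho_gt0).
rewrite normrM (ger0_norm c0) ler_wpM2l//; apply: IH.
have := ltn_ord k => kn; rewrite ltn_subrL /= addn_gt0.
by rewrite (leq_trans _ kn) ?orbT.
Qed.

End NBonacci.

(** * Size of B and of the orbit in terms of products of multipliers *)

Section Growth.
Context {R : realType}.
Variables (n : nat) (B : nat -> nat -> R).
Hypothesis n2 : (2 <= n)%N.
Let beta j := B j.+1 j.
Hypothesis b3 : forall l j, (l < j)%N -> 3 <= `|B j l|.
Hypothesis b2 : forall l j, (l < j)%N -> 2 * `|B j l| <= `|B j.+1 l|.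
Hypothesis bd : forall l j, (l < j)%N ->
  `|B j.+1 l - beta j * B j l| <= Num.max `|beta j| `|B j l|.
Hypothesis bb : forall j, 2 * `|beta j| <= `|beta j.+1|.
Hypothesis bn : forall j, B (j + n)%N j = beta (j + n)%N.

Definition gprod j := \prod_(k < j) beta k.
Let P j : R := `|gprod j|.

Lemma gprodS j : gprod j.+1 = beta j * gprod j.
Proof. by rewrite /gprod big_ord_recr mulrC. Qed.

Lemma beta_ge3 j : 3 <= `|beta j|. Proof. exact: b3. Qed.

Lemma beta_gt0 j : 0 < `|beta j|.
Proof. by apply: lt_le_trans (beta_ge3 j). Qed.

Lemma gnormS j : P j.+1 = `|beta j| * P j.
Proof. by rewrite /P gprodS normrM. Qed.

Lemma gnorm0 : P 0 = 1.
Proof. by rewrite /P /gprod big_ord0 normr1. Qed.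

Lemma gnorm_gt0 j : 0 < P j.
Proof.
elim: j => [|j IH]; first by rewrite gnorm0.
by rewrite gnormS mulr_gt0// beta_gt0.
Qed.

Lemma gnorm_ge0 j : 0 <= P j.
Proof. exact: normr_ge0. Qed.

Lemma gprod_neq0 j : gprod j != 0.
Proof. by rewrite -normr_gt0 gnorm_gt0. Qed.

Lemma beta_geo l k : `|beta l| * 2 ^+ k <= `|beta (l + k)%N|.
Proof.
elim: k => [|k IH]; first by rewrite expr0 mulr1 addn0.
rewrite addnS; apply: le_trans (bb _); rewrite exprS mulrCA.
by rewrite ler_pM2l.
Qed.

Lemma beta_ge j : 3 * 2 ^+ j <= `|beta j|.
Proof.
apply: le_trans (beta_geo 0 j).
by rewrite ler_wpM2r ?exprn_ge0// beta_ge3.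
Qed.

Lemma beta_ge_geo j : 2 ^+ j <= `|beta j|.
Proof.
by apply: le_trans (beta_ge j); rewrite ler_peMl ?exprn_ge0// ler1n.
Qed.

Lemma gnorm_mono i j : (i <= j)%N -> P i <= P j.
Proof.
move=> /subnK <-; elim: (j - i)%N => // k IH; rewrite addSn gnormS.
apply: le_trans IH _; apply: ler_peMl; first exact: gnorm_ge0.
by apply: le_trans (beta_ge3 _); rewrite ler1n.
Qed.

Lemma gnorm_geo i j : (i < j)%N -> 2 ^+ i * P i <= P j.
Proof.
move=> ij; apply: le_trans (gnorm_mono ij); rewrite gnormS.
by rewrite ler_wpM2r ?gnorm_ge0// beta_ge_geo.
Qed.

Lemma B_geo l m : 2 ^+ m * `|beta l| <= `|B (l + m).+1 l|.
Proof.
elim: m => [|m IH]; first by rewrite addn0 expr0 mul1r.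
rewrite addnS; apply: le_trans (b2 _); last by rewrite ltnS leq_addr.
by rewrite exprS -mulrA ler_pM2l.
Qed.

Definition defect l : R := 2 / `|beta l|.

Lemma defect_gt0 l : 0 < defect l.
Proof. by rewrite divr_gt0// beta_gt0. Qed.

Lemma defect_ge0 l : 0 <= defect l.
Proof. exact: ltW (defect_gt0 l). Qed.

Lemma defect_le l : defect l <= 2 / 3 * 2 ^- l.
Proof.
have b := beta_ge l; rewrite /defect -mulrA ler_pM2l// -invfM.
by rewrite lef_pV2 // posrE ?beta_gt0// mulr_gt0 ?exprn_gt0.
Qed.

Lemma defect_le23 l : defect l <= 2 / 3.
Proof. by rewrite /defect ler_pM2l// lef_pV2 ?posrE ?beta_gt0// beta_ge3. Qed.

(** The ratio is 1 at m = 0. Each step multiplies it by a factor between 1 - e and 1 + e with e =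
    2^{-m} / |beta_l|: the error is at most the larger of |beta_j| and |B j l|, and both are at
    least 2^m |beta_l|. These e sum to [defect l]. The upper bound is a product to avoid dividing by
    1 - s. *)
Lemma ratio_bounds l m :
  let r := `|B (l + m).+1 l| * P l / P (l + m).+1 in
  let s := defect l * (1 - 2 ^- m) in 1 - s <= r /\ r * (1 - s) <= 1.
Proof.
elim: m => [|m [IH1 IH2]] /=.
  rewrite expr0 invr1 subrr mulr0 subr0 mulr1 addn0 gnormS -/(beta l).
  by rewrite divff// gt_eqF// mulr_gt0 ?beta_gt0// gnorm_gt0.
set j := (l + m).+1 in IH1 IH2 *; rewrite addnS -/j.
set r := _ / _ in IH1 IH2; set s := _ * (1 - 2 ^- m) in IH1 IH2.
pose e := 2 ^- m / `|beta l|.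
have s' : defect l * (1 - 2 ^- m.+1) = s + e.
  rewrite /s /e /defect half_exprS; field.
  by rewrite expf_neq0//= gt_eqF// beta_gt0.
have e0 : 0 < e by rewrite divr_gt0 ?half_expr_gt0// beta_gt0.
have lj : (l < j)%N by rewrite /j ltnS leq_addr.
have Bj0 : 0 < `|B j l| by apply: lt_le_trans (b3 lj).
have e1 : e * (2 ^+ m * `|beta l|) = 1.
  by rewrite /e; field; rewrite expf_neq0//= gt_eqF// beta_gt0.
have e0' : 0 <= e by exact: ltW.
have eB : 1 <= e * `|B j l| by rewrite -e1 ler_wpM2l// B_geo.
have ebeta : 1 <= e * `|beta j|.
  rewrite -e1 ler_wpM2l// mulrC; apply: le_trans (beta_geo l m) _.
  by apply: le_trans (bb _); rewrite ler_peMl// ler1n.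
have dd : Num.max `|beta j| `|B j l| <= e * (`|beta j| * `|B j l|).
  rewrite ge_max; apply/andP; split.
    by rewrite mulrCA ler_peMr.
  by rewrite mulrA ler_peMl.
have tri1 : `|B j.+1 l| <= (1 + e) * (`|beta j| * `|B j l|).
  rewrite -[B j.+1 l](subrK (beta j * B j l)); apply: le_trans (ler_normD _ _) _.
  rewrite normrM mulrDl mul1r addrC lerD2l; apply: le_trans dd.
  exact: bd.
have tri2 : (1 - e) * (`|beta j| * `|B j l|) <= `|B j.+1 l|.
  rewrite mulrBl mul1r -normrM lerBlDr.
  rewrite -{1}[beta j * B j l](subKr (B j.+1 l)); apply: le_trans (ler_normB _ _) _.
  by rewrite lerD2l normrM; apply: le_trans dd; exact: bd.
have Q0 : 0 < P l / P j.+1 by rewrite divr_gt0 ?gnorm_gt0.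
have rE : (`|beta j| * `|B j l|) * (P l / P j.+1) = r.
  rewrite /r gnormS; field.
  by rewrite !gt_eqF// ?gnorm_gt0 ?beta_gt0.
have r1 : `|B j.+1 l| * P l / P j.+1 <= (1 + e) * r.
  by rewrite -[leLHS]mulrA -rE [leRHS]mulrA ler_pM2r.
have r2 : (1 - e) * r <= `|B j.+1 l| * P l / P j.+1.
  by rewrite -[leRHS]mulrA -rE [leLHS]mulrA ler_pM2r.
(* Keeps 1 - s and 1 - e positive, hence r as well. *)
have se23 : s + e <= 2 / 3.
  rewrite -s'; apply: le_trans (_ : defect l * 1 <= _); last by rewrite mulr1 defect_le23.
  by rewrite ler_wpM2l ?defect_ge0// gerBl half_expr_ge0.
have s0 : 0 <= s.
  rewrite mulr_ge0 ?defect_ge0// subr_ge0 invf_le1 ?exprn_gt0//.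
  by rewrite exprn_ege1// ler1n.
rewrite s'; move: r1 r2 IH1 IH2; set r' := _ / P j.+1; move=> r1 r2 IH1 IH2.
split.
  by apply: le_trans r2; nra.
apply: le_trans (_ : (1 + e) * r * (1 - (s + e)) <= _); first by nra.
have r0 : 0 < r by lra.
by nra.
Qed.

Lemma ratio_ge l j : (l < j)%N -> (1 - defect l) * P j <= `|B j l| * P l.
Proof.
move=> lj; have [+ _] := ratio_bounds l (j - l.+1).
rewrite -addSn subnKC// => h; rewrite -ler_pdivlMr ?gnorm_gt0//.
apply: le_trans h; rewrite lerD2l lerN2.
by apply: ler_piMr; rewrite ?defect_ge0 ?gerBl ?half_expr_ge0.
Qed.

Lemma ratio_le l j : (l < j)%N -> `|B j l| * P l * (1 - defect l) <= P j.
Proof.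
move=> lj; have [+ +] := ratio_bounds l (j - l.+1).
rewrite -addSn subnKC// => h0 h; rewrite -[leRHS]mul1r -ler_pdivrMr ?gnorm_gt0//.
rewrite mulrAC; apply: le_trans h; rewrite ler_wpM2l//.
  by rewrite divr_ge0 ?mulr_ge0 ?gnorm_ge0.
rewrite lerD2l lerN2.
by apply: ler_piMr; rewrite ?defect_ge0 ?gerBl ?half_expr_ge0.
Qed.

Lemma B_lower l j : (l < j)%N -> P j <= 3 * (`|B j l| * P l).
Proof.
move=> lj; have := ratio_ge lj; have := defect_le23 l; have := gnorm_gt0 j.
by move: (_ * P l) (P j) (defect l) => x y d; nra.
Qed.

Lemma gnorm_log_defect i :
  `|ln (P (i + n).+1) - 2 * ln (P (i + n)%N) + ln (P i)| <= 2 * 2 ^- i.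
Proof.
have ii : (i < i + n)%N by rewrite -[ltnLHS]addn0 ltn_add2l (leq_trans _ n2).
have := ratio_ge ii; have := ratio_le ii; rewrite bn.
have := defect_le i; have := defect_le23 i; have := defect_gt0 i.
set d := defect i => d0 d23 dle; rewrite gnormS.
have bp := beta_gt0 (i + n); have p1 := gnorm_gt0 i; have p2 := gnorm_gt0 (i + n).
move=> h1 h2.
have d1 : 0 < 1 - d by lra.
(* For d <= 2/3 one has (1 + 3 d) (1 - d) >= 1; with d <= (2/3) 2^{-i} this yields the bound 2 *
   2^{-i}. *)
have ln3 : - ln (1 - d) <= 3 * d.
  rewrite -lnV ?posrE//; apply: le_trans (_ : ln (1 + 3 * d) <= _).
    rewrite ler_ln ?posrE ?invr_gt0//; last by lra.
    by rewrite -[leLHS]mul1r ler_pdivrMr//; nra.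
  by apply: le_ln1Dx; lra.
have b1 : ln (1 - d) + ln (P (i + n)%N) <= ln `|beta (i + n)| + ln (P i).
  by rewrite -!lnM ?posrE// ler_ln ?posrE ?mulr_gt0.
have b2' : ln `|beta (i + n)| + ln (P i) + ln (1 - d) <= ln (P (i + n)%N).
  by rewrite -!lnM ?posrE ?mulr_gt0// ler_ln ?posrE ?mulr_gt0.
rewrite lnM ?posrE// ler_norml; apply/andP; split; lra.
Qed.

Lemma gnorm_powR rho : 0 < rho -> rho ^+ n = \sum_(k < n) rho ^+ k ->
  exists2 C, 0 < C & forall i,
    P i.+1 <= C * P i `^ rho /\ P i `^ rho <= C * P i.+1.
Proof.
move=> rho0 rhoE.
have [M HM] := nbonacci_defect_bounded rho0 rhoE (ler0n R 2) gnorm_log_defect.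
exists (expR M) => [|i]; first exact: expR_gt0.
have := HM i; rewrite ler_norml => /andP[h1 h2].
have pE : P i `^ rho = expR (rho * ln (P i)).
  by rewrite /powR gt_eqF// gnorm_gt0.
have sE : P i.+1 = expR (ln (P i.+1)) by rewrite lnK// posrE gnorm_gt0.
by split; rewrite pE [P i.+1]sE -expRD ler_expR; lra.
Qed.

(** Makes the subtracted vector of the recursion a relative error 2^{-j}. *)
Lemma gnorm_gap j : P j <= 2 ^- j * P (j + n).+1.
Proof.
rewrite mulrC ler_pdivlMr ?exprn_gt0// mulrC; apply: gnorm_geo.
by rewrite ltnS leq_addr.
Qed.

Section Vectors.
Variables (V : normedModType R) (z : nat -> V).
Hypothesis z_rec : forall j, z (j + n).+1 = beta (j + n)%N *: z (j + n)%N - z j.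

Lemma orbit_norm_upper : exists2 C, 0 < C & forall i, `|z i| <= C * P i.
Proof.
pose C0 := 1 + \sum_(k < n.+1) `|z k|.
have C00 : 0 < C0 by rewrite ltr_pwDl// sumr_ge0.
suff H j k : (k <= j + n)%N -> `|z k| <= C0 * geo_prod 1 j * P k.
  exists (C0 * expR (2 * 1)) => [|i]; first by rewrite mulr_gt0// expR_gt0.
  apply: le_trans (H i i (leq_addr _ _)) _.
  rewrite ler_wpM2r ?gnorm_ge0// ler_wpM2l ?(ltW C00)//.
  exact: geo_prod_le.
have E0 i : 0 <= C0 * geo_prod 1 i by rewrite mulr_ge0 ?(ltW C00) ?geo_prod_ge0.
elim: j k => [|j IH] k.
  rewrite add0n -ltnS => kn; rewrite /geo_prod big_ord0 mulr1.
  apply: (@le_trans _ _ C0).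
    rewrite /C0 (bigD1 (Ordinal kn))//= addrCA lerDl addr_ge0// sumr_ge0//.
  rewrite ler_peMr ?(ltW C00)// -gnorm0; exact: gnorm_mono.
rewrite addSn leq_eqVlt => /orP[/eqP->|]; last first.
  rewrite ltnS => /IH h; apply: le_trans h _.
  by rewrite ler_wpM2r ?gnorm_ge0// ler_wpM2l ?(ltW C00)// geo_prod_leS.
rewrite z_rec; apply: le_trans (ler_normB _ _) _; rewrite normrZ.
have h1 := IH _ (leqnn (j + n)); have h2 := IH _ (leq_addr n j).
have h3 : `|beta (j + n)| * `|z (j + n)%N| <= C0 * geo_prod 1 j * P (j + n).+1.
  by rewrite gnormS mulrCA ler_wpM2l.
have h4 : C0 * geo_prod 1 j * P j <= C0 * geo_prod 1 j * (2 ^- j * P (j + n).+1).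
  by rewrite ler_wpM2l// gnorm_gap.
apply: le_trans (lerD h3 (le_trans h2 h4)) _.
by rewrite geo_prodS le_eqVlt; apply/orP; left; apply/eqP; ring.
Qed.
End Vectors.

Lemma normalized_orbit_cvg (V : completeNormedModType R) (z : nat -> V) :
  (forall j, z (j + n).+1 = beta (j + n)%N *: z (j + n)%N - z j) ->
  cvgn (fun i => (gprod i)^-1 *: z i).
Proof.
move=> z_rec; pose u i := (gprod (i + n))^-1 *: z (i + n)%N.
suff /cvg_ex[l ul] : cvgn u.
  by apply/cvg_ex; exists l; rewrite -(cvg_shiftn n).
have [C C0 zC] := orbit_norm_upper z_rec.
(* The multiple of the previous vector cancels after rescaling, and the difference of consecutive
   terms is - z_i / [gprod (i + n).+1]. *)
have step i : `|telescope u i| <= C * 2^-1 ^+ i.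
  rewrite /telescope /= /u addSn gprodS z_rec scalerBr scalerA invfM.
  rewrite mulrAC mulVf ?mul1r; last by rewrite -normr_gt0 beta_gt0.
  rewrite addrAC subrr add0r normrN normrZ -invfM -gprodS normfV.
  rewrite mulrC ler_pdivrMr ?normr_gt0 ?gprod_neq0//.
  apply: le_trans (zC i) _; rewrite -mulrA ler_pM2l//.
  by apply: le_trans (gnorm_gap i) _; rewrite exprVn.
have /normed_cvg cu : cvgn [normed series (telescope u)].
  apply: (@series_le_cvg _ _ (geometric C 2^-1)).
  - by move=> i; exact: normr_ge0.
  - by move=> i; rewrite /geometric /= mulr_ge0 ?(ltW C0)// exprn_ge0.
  - by move=> i; exact: step.
  - by apply: is_cvg_geometric_series; rewrite ger0_norm// invf_lt1// ltr1n.
rewrite (_ : u = (fun i => u 0%N + series (telescope u) i)).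
  by apply: is_cvgD => //; exact: is_cvg_cst.
by apply/funext => i; exact: eq_sum_telescope.
Qed.

Section Wedges.
Variables (V : normedModType R) (W : nat -> nat -> V).
Hypothesis W_sym : forall k l, `|W k l| = `|W l k|.
Hypothesis W_diag : forall k, W k k = 0.
Hypothesis W_rec : forall j l,
  W (j + n).+1 l = beta (j + n)%N *: W (j + n)%N l - W j l.

(** Unlike for B, the diagonal is 0, so no lower bound on W is at hand to absorb errors; the
    induction carries a constant E_j that grows by 1 + 2 * 2^{-j} at each step. *)
Lemma wedge_norm_upper :
  exists2 C, 0 < C & forall l j, (l < j)%N -> `|W j l| * P l <= C * P j.
Proof.
pose C0 := 1 + \sum_(k < n.+1) \sum_(l < n.+1) `|W k l| * P l.
have s0 : 0 <= \sum_(k < n.+1) \sum_(l < n.+1) `|W k l| * P l.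
  by apply: sumr_ge0 => k _; apply: sumr_ge0 => l _; rewrite mulr_ge0 ?gnorm_ge0.
have C00 : 0 < C0 by rewrite ltr_pwDl.
pose E j := C0 * geo_prod 2 j.
have E0 j : 0 <= E j by rewrite mulr_ge0 ?(ltW C00) ?geo_prod_ge0.
have ES j : E j.+1 = E j + E j * (2 * 2 ^- j) by rewrite /E geo_prodS; ring.
have E00 : E 0%N = C0 by rewrite /E /geo_prod big_ord0 mulr1.
have Ele j : E j <= C0 * expR (2 * 2).
  by rewrite /E ler_wpM2l ?(ltW C00)//; exact: geo_prod_le.
clearbody E.
suff H j k l : (l < k <= j + n)%N -> `|W k l| * P l <= E j * P k.
  exists (C0 * expR (2 * 2)) => [|l j lj]; first by rewrite mulr_gt0// expR_gt0.
  apply: le_trans (H j j l _) _; first by rewrite lj leq_addr.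
  by rewrite ler_wpM2r ?gnorm_ge0.
elim: j k l => [|j IH] k l.
  rewrite add0n => /andP[lk kn]; rewrite E00.
  have kn' : (k < n.+1)%N by []. have ln' : (l < n.+1)%N by exact: ltn_trans kn'.
  apply: (@le_trans _ _ C0).
    rewrite /C0 (bigD1 (Ordinal kn'))//= (bigD1 (Ordinal ln'))//=.
    rewrite addrCA -addrA lerDl addr_ge0//.
      by apply: sumr_ge0 => i _; rewrite mulr_ge0 ?gnorm_ge0.
    rewrite addr_ge0//; apply: sumr_ge0 => i _.
    by apply: sumr_ge0 => i' _; rewrite mulr_ge0 ?gnorm_ge0.
  rewrite ler_peMr ?(ltW C00)// -gnorm0; exact: gnorm_mono.
have Emono : E j <= E j.+1 by rewrite ES lerDl mulr_ge0// mulr_ge0// half_expr_ge0.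
rewrite addSn => /andP[lk]; rewrite leq_eqVlt => /orP[/eqP kE|]; last first.
  rewrite ltnS => kj; apply: le_trans (IH k l _) _; first by rewrite lk.
  by rewrite ler_wpM2r ?gnorm_ge0.
have n1 : (j < j + n)%N by rewrite -[ltnLHS]addn0 ltn_add2l (leq_trans _ n2).
rewrite kE in lk *; rewrite W_rec; move: lk; rewrite ltnS leq_eqVlt => /orP[/eqP->|lj].
  (* For l = j + n the main term vanishes and what remains is W at (j + n, j). Its bound E_j P_{j+n}
     / P_j is compared with |beta_{j+n}| through [ratio_ge], at the cost of the factor 1 + 3
     [defect j]. *)
  rewrite W_diag scaler0 sub0r normrN W_sym gnormS mulrA ler_wpM2r ?gnorm_ge0//.
  have h := IH (j + n)%N j; rewrite n1 leqnn in h; have {}h := h isT.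
  have := ratio_ge n1; rewrite bn => h2.
  have d1 := defect_le j; have d23 := defect_le23 j; have d0 := defect_ge0 j.
  rewrite -(ler_pM2r (gnorm_gt0 j)); apply: le_trans h _; rewrite -mulrA.
  have {h2} h3 : P (j + n) <= (1 + 3 * defect j) * (`|beta (j + n)| * P j).
    have p0 := gnorm_gt0 (j + n).
    apply: le_trans (_ : (1 + 3 * defect j) * ((1 - defect j) * P (j + n)) <= _).
      by rewrite mulrA ler_peMl ?gnorm_ge0//; nra.
    by rewrite ler_wpM2l//; lra.
  apply: le_trans (_ : E j * ((1 + 3 * defect j) * (`|beta (j + n)| * P j)) <= _).
    by rewrite ler_wpM2l.
  rewrite [leLHS]mulrA; apply: ler_wpM2r; first by rewrite mulr_ge0 ?gnorm_ge0.
  by rewrite ES mulrDr mulr1 lerD2l ler_wpM2l//; lra.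
have h := IH (j + n)%N l; rewrite lj leqnn in h; have {}h := h isT.
have hW : `|W j l| * P l <= E j * (2 * 2 ^- j * P (j + n).+1).
  have gap2 : 2 ^- j * P (j + n).+1 <= 2 * 2 ^- j * P (j + n).+1.
    rewrite -mulrA ler_peMl ?ler1n// mulr_ge0 ?half_expr_ge0 ?gnorm_ge0//.
  have [lt|gt|->] := ltngtP l j; last first.
  - by rewrite W_diag normr0 mul0r mulr_ge0// mulr_ge0 ?gnorm_ge0// mulr_ge0 ?half_expr_ge0.
  - have h' := IH l j; rewrite gt (ltnW lj) in h'; have {}h' := h' isT.
    rewrite W_sym -(ler_pM2r (gnorm_gt0 j)).
    apply: le_trans (_ : E j * P l * P l <= _).
      by rewrite mulrAC ler_wpM2r ?gnorm_ge0.
    rewrite -!mulrA ler_wpM2l//.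
    (* For l > j the induction hypothesis bounds W at (l, j), with P_l / P_j in the wrong direction.
       Multiplying [q1] and [q2] gives 4^j P_l^2 <= P_j P_{j+n+1}, which makes up for it. *)
    have q1 : 2 ^+ j * P l <= P (j + n).
      apply: le_trans (_ : `|beta l| * P l <= _); last first.
        by rewrite -gnormS gnorm_mono.
      rewrite ler_wpM2r ?gnorm_ge0//; apply: le_trans (beta_ge_geo l).
      by rewrite ler_eXn2l ?ltr1n// ltnW.
    have q2 : 2 ^+ j * P l <= `|beta (j + n)| * P j.
      have q3 : 3 * (2 ^+ j * P l) <= P (j + n).
        apply: le_trans (_ : `|beta l| * P l <= _); last first.
          by rewrite -gnormS gnorm_mono.
        rewrite mulrA ler_wpM2r ?gnorm_ge0//; apply: le_trans (beta_ge l).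
        by rewrite ler_pM2l// ler_eXn2l ?ltr1n// ltnW.
      by have := B_lower n1; rewrite bn; lra.
    have t0 : 0 < 2 ^+ j :> R by rewrite exprn_gt0.
    have t1 : 1 <= 2 ^+ j :> R by rewrite exprn_ege1// ler1n.
    have p0 := gnorm_ge0 l.
    rewrite gnormS (_ : 2 * _ = 2 ^- j * (2 * ((`|beta (j + n)| * P j) * P (j + n)))); last by ring.
    rewrite [leRHS]mulrC ler_pdivlMr//.
    apply: le_trans (_ : (2 ^+ j * P l) * (2 ^+ j * P l) <= _).
      rewrite (_ : P l * P l * 2 ^+ j = 2 ^+ j * P l * P l); last by ring.
      rewrite ler_wpM2l//; first by rewrite mulr_ge0// ltW.
      by rewrite ler_peMl.
    apply: le_trans (_ : `|beta (j + n)| * P j * P (j + n) <= _).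
      by apply: ler_pM => //; rewrite mulr_ge0// ltW.
    by rewrite ler_peMl ?ler1n// !mulr_ge0 ?gnorm_ge0.
  - have h' := IH j l; rewrite lt (leq_addr n j) in h'; have {}h' := h' isT.
    apply: le_trans h' _; rewrite ler_wpM2l//; apply: le_trans gap2.
    exact: gnorm_gap.
apply: le_trans (_ : (`|beta (j + n)| * `|W (j + n)%N l| + `|W j l|) * P l <= _).
  by rewrite ler_wpM2r ?gnorm_ge0// -normrZ ler_normB.
rewrite mulrDl ES mulrDl; apply: lerD; last by rewrite -!mulrA in hW *.
by rewrite gnormS -mulrA [leRHS]mulrCA ler_wpM2l.
Qed.
End Wedges.

End Growth.

(** * Norms, projective space and extension of scalars *)

Section MatrixNorms.
Context {R : realType}.

Lemma mx_entry_le m p (M : 'M[R]_(m, p)) i j : `|M i j| <= `|M|.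
Proof.
rewrite [leRHS]/Num.Def.normr /= mx_normrE.
exact: (le_bigmax _ (fun ij => `|M ij.1 ij.2|) (i, j)).
Qed.

Lemma mx_norm_le m p (M : 'M[R]_(m, p)) (c : R) :
  0 <= c -> (forall i j, `|M i j| <= c) -> `|M| <= c.
Proof.
move=> c0 H; rewrite [leLHS]/Num.Def.normr /= mx_normrE.
by apply: bigmax_le => // -[i j] _; exact: H.
Qed.

Lemma mx_norm_mul m p q (M : 'M[R]_(m, p)) (N : 'M[R]_(p, q)) :
  `|M *m N| <= p%:R * `|M| * `|N|.
Proof.
apply: mx_norm_le => [|i j]; first by rewrite !mulr_ge0.
rewrite mxE; apply: le_trans (ler_norm_sum _ _ _) _.
apply: (@le_trans _ _ (\sum_(k < p) `|M| * `|N|)).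
  apply: ler_sum => k _; rewrite normrM.
  by apply: ler_pM; rewrite ?normr_ge0 ?mx_entry_le.
by rewrite sumr_const card_ord -mulrA mulr_natl.
Qed.

Lemma mx_norm_tr m p (M : 'M[R]_(m, p)) : `|M^T| = `|M|.
Proof.
apply/eqP; rewrite eq_le; apply/andP; split;
  apply: mx_norm_le => // i j; last by have := mx_entry_le M^T j i; rewrite mxE.
by rewrite mxE mx_entry_le.
Qed.

Lemma bil_norm m (S : 'M[R]_m) (x y : 'rV[R]_m) :
  `|bil S x y| <= m%:R * m%:R * `|S| * `|x| * `|y|.
Proof.
apply: le_trans (mx_entry_le _ _ _) _; apply: le_trans (mx_norm_mul _ _) _.
rewrite mx_norm_tr ler_wpM2r// -!mulrA ler_wpM2l//.
apply: le_trans (mx_norm_mul _ _) _.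
by rewrite -!mulrA ler_wpM2l// mulrC.
Qed.

(** Estimates are made in the sup norm, written with bars, and carried over to the Euclidean norms
    at the end, at the cost of a factor depending on the dimension. *)
Lemma enorm_ge m (x : 'rV[R]_m) : `|x| <= enorm x.
Proof.
apply: mx_norm_le => [|i j]; first exact: sqrtr_ge0.
rewrite ord1 -sqrtr_sqr ler_wsqrtr// (bigD1 j)//= lerDl.
by apply: sumr_ge0 => k _; exact: sqr_ge0.
Qed.

Lemma enorm_le m (x : 'rV[R]_m) : enorm x <= m%:R * `|x|.
Proof.
rewrite -[leRHS]ger0_norm ?mulr_ge0// -sqrtr_sqr ler_wsqrtr//.
apply: (@le_trans _ _ (\sum_(i < m) `|x| ^+ 2)).
  apply: ler_sum => i _; rewrite -real_normK ?num_real//.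
  by rewrite lerXn2r ?nnegrE ?mx_entry_le.
rewrite sumr_const card_ord exprMn -[leLHS]mulr_natl ler_wpM2r ?sqr_ge0//.
by rewrite -natrX ler_nat; case: (m) => // k; rewrite -mulnn leq_pmulr.
Qed.

Lemma enormZ m c (x : 'rV[R]_m) : enorm (c *: x) = `|c| * enorm x.
Proof.
rewrite /enorm -sqrtr_sqr -sqrtrM ?sqr_ge0// mulr_sumr.
by congr Num.sqrt; apply: eq_bigr => i _; rewrite mxE exprMn.
Qed.

Lemma wnormZ m c (w : 'M[R]_m) : wnorm (c *: w) = `|c| * wnorm w.
Proof.
rewrite /wnorm -sqrtr_sqr -sqrtrM ?sqr_ge0// mulr_sumr.
congr Num.sqrt; apply: eq_bigr => i _; rewrite mulr_sumr.
by apply: eq_bigr => j _; rewrite mxE exprMn.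
Qed.

Lemma wedgeC m (x y : 'rV[R]_m) : wedge y x = - wedge x y.
Proof. by rewrite /wedge opprB. Qed.

Lemma wedge_tr m (x y : 'rV[R]_m) : (wedge x y)^T = - wedge x y.
Proof. by rewrite -wedgeC /wedge linearB /= !trmx_mul !trmxK. Qed.

Lemma wedgexx m (x : 'rV[R]_m) : wedge x x = 0.
Proof. by rewrite /wedge subrr. Qed.

Lemma wedgeZl m c (x y : 'rV[R]_m) : wedge (c *: x) y = c *: wedge x y.
Proof. by rewrite /wedge linearZ /= -scalemxAl -scalemxAr scalerBr. Qed.

Lemma wedgeZr m c (x y : 'rV[R]_m) : wedge x (c *: y) = c *: wedge x y.
Proof. by rewrite wedgeC wedgeZl [wedge y x]wedgeC scalerN opprK. Qed.

Lemma wedgeBl m (x x' y : 'rV[R]_m) : wedge (x - x') y = wedge x y - wedge x' y.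
Proof.
by rewrite /wedge linearB /= mulmxBl mulmxBr !opprD addrACA.
Qed.

Lemma wedge_norm m (x y : 'rV[R]_m) : `|wedge x y| <= 2 * `|x| * `|y|.
Proof.
apply: le_trans (ler_normB _ _) _.
have h (u v : 'rV[R]_m) : `|u^T *m v| <= `|u| * `|v|.
  by apply: le_trans (mx_norm_mul _ _) _; rewrite mx_norm_tr mul1r.
rewrite -mulrA mulr2n mulrDl mul1r lerD ?h//.
by apply: le_trans (h _ _) _; rewrite mulrC.
Qed.

Lemma mul_rV_wedge m (v x y : 'rV[R]_m) :
  v *m wedge x y = (v *m x^T) 0 0 *: y - (v *m y^T) 0 0 *: x.
Proof.
rewrite /wedge mulmxBr !mulmxA.
by rewrite [v *m x^T]mx11_scalar [v *m y^T]mx11_scalar !mul_scalar_mx !mxE.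
Qed.

Lemma wnorm_le m (w : 'M[R]_m) : wnorm w <= m%:R * `|w|.
Proof.
rewrite -[leRHS]ger0_norm ?mulr_ge0// -sqrtr_sqr ler_wsqrtr//.
apply: (@le_trans _ _ (\sum_(i < m) \sum_(j < m) `|w| ^+ 2)).
  apply: ler_sum => i _; rewrite big_mkcond /=; apply: ler_sum => j _.
  case: ifP => _; last exact: sqr_ge0.
  rewrite -real_normK ?num_real//.
  by rewrite lerXn2r ?nnegrE ?mx_entry_le.
by rewrite !sumr_const !card_ord exprMn -mulrnA -[leLHS]mulr_natl natrM -expr2.
Qed.

Lemma wnorm_ge m (x y : 'rV[R]_m) : `|wedge x y| <= wnorm (wedge x y).
Proof.
have up (i j : 'I_m) : (i < j)%N -> `|wedge x y i j| <= wnorm (wedge x y).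
  move=> ij; rewrite -sqrtr_sqr ler_wsqrtr// (bigD1 i)//= (bigD1 j)//=.
  rewrite -addrA lerDl addr_ge0 ?sumr_ge0// => k _; rewrite ?sqr_ge0//.
  by apply: sumr_ge0 => l _; exact: sqr_ge0.
apply: mx_norm_le => [|i j]; first exact: sqrtr_ge0.
have [|ji|/val_inj->] := ltngtP i j; first exact: up.
  have := congr1 (fun M : 'M[R]_m => M j i) (wedge_tr x y); rewrite mxE [RHS]mxE => ->.
  by rewrite normrN up.
have := congr1 (fun M : 'M[R]_m => M j j) (wedge_tr x y); rewrite mxE [RHS]mxE.
move=> /eqP; rewrite -addr_eq0 -mulr2n mulrn_eq0 /= => /eqP ->.
by rewrite normr0 sqrtr_ge0.
Qed.

End MatrixNorms.

(** * Points and convergence in projective space *)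

Section ProjectiveSpace.
Local Open Scope quotient_scope.
Context {R : realType} {n : nat}.
Implicit Types (u v : 'rV[R]_n.+1).

Lemma val_insubd_nz v : v != 0 -> val (insubd (e0_nz R n) v) = v.
Proof. by move=> v0; apply: insubdK; apply/mem_set. Qed.

Lemma pt_eqP u v : u != 0 -> v != 0 ->
  pt u = pt v <-> exists2 c : R, c != 0 & u = c *: v.
Proof.
move=> u0 v0; split.
  move=> /(@eqquotP _ (prop_equiv R n) _ _) /asboolP[c c0].
  by rewrite !val_insubd_nz//; exists c.
move=> [c c0 e]; apply/(@eqquotP _ (prop_equiv R n) _ _)/asboolP.
by exists c => //; rewrite !val_insubd_nz.
Qed.

Lemma rvec_pt v : v != 0 -> exists2 c : R, c != 0 & rvec (pt v) = c *: v.
Proof.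
move=> v0; have e := reprK (pt v).
move: e => /(@eqquotP _ (prop_equiv R n) _ _) /asboolP[c c0].
by rewrite val_insubd_nz//; exists c.
Qed.

Lemma pt_cvg (u : nat -> 'rV[R]_n.+1) (v : 'rV[R]_n.+1) :
  (forall i, u i != 0) -> v != 0 -> u @ \oo --> v ->
  (fun i => pt (u i)) @ \oo --> pt v.
Proof.
move=> u0 v0 uv.
have cv : (fun i => insubd (e0_nz R n) (u i)) @ \oo --> insubd (e0_nz R n) v.
  move=> A [_ [[C oC <-] Cv CA]].
  have Cnb : nbhs v C.
    by apply: open_nbhs_nbhs; split => //; rewrite -(val_insubd_nz v0); exact: Cv.
  have [N _ HN] := uv _ Cnb; exists N => // i Ni; apply: CA.
  by have Ci := HN i Ni; rewrite /= -(val_insubd_nz (u0 i)) in Ci; exact: Ci.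
have pc : continuous (\pi_(projspace R n) : nzvec R n -> projspace R n).
  exact: pi_continuous.
exact: (continuous_cvg _ (pc (insubd (e0_nz R n) v)) cv).
Qed.
End ProjectiveSpace.

(** * Integral matrices of the two families of forms *)

Section FormMatrix.

Lemma map_ivec (K K' : pzRingType) (f : {rmorphism K -> K'}) m (x : 'rV[int]_m) :
  map_mx f (ivec K x) = ivec K' x.
Proof. by apply/rowP => i; rewrite !mxE rmorph_int. Qed.

Lemma bil_ivec (K : comPzRingType) m (S : 'M[int]_m) (x y : 'rV[int]_m) :
  bil (map_mx intr S) (ivec K x) (ivec K y) = (bil S x y)%:~R.
Proof.
by rewrite /bil /ivec matrix.map_trmx -!map_mxM /= mxE.
Qed.

Lemma bil_polar (K : comPzRingType) m (S : 'M[K]_m) (q : 'rV[K]_m -> K) x y :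
  (forall t, q t = bil S t t) -> polar q x y = bil (S + S^T) x y.
Proof.
move=> qE; rewrite /polar !qE !bilDl !bilDr bil_addmx bil_tr; ring.
Qed.

Lemma sum_square_split (K : nmodType) m (F : 'I_m -> 'I_m -> K) :
  \sum_j \sum_i F i j =
  \sum_i F i i + \sum_(i < m) \sum_(j < m | (i < j)%N) (F i j + F j i).
Proof.
transitivity (\sum_(j < m) \sum_(i < m | (i < j)%N) F i j + \sum_j F j j
   + \sum_(j < m) \sum_(i < m | (j < i)%N) F i j).
  rewrite -!big_split /=; apply: eq_bigr => j _.
  rewrite (bigID (fun i : 'I_m => (i < j)%N)) /= -addrA; congr (_ + _).
  rewrite (bigD1 j) ?ltnn//=; congr (_ + _); apply: eq_bigl => i.
  by rewrite -leqNgt ltn_neqAle andbC eq_sym.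
rewrite addrAC addrC; congr (_ + _).
under [RHS]eq_bigr do rewrite big_split /=.
rewrite big_split /=; congr (_ + _).
by rewrite (exchange_big_dep xpredT).
Qed.

Lemma qext_bil (R : realType) m (A : 'M[int]_m) (q : 'rV[rat]_m -> rat) :
  (forall t, q t = bil (map_mx intr A) t t) ->
  forall t : 'rV[R]_m, qext q t = bil (map_mx intr A) t t.
Proof.
move=> qE t; rewrite bilE sum_square_split /qext.
have e (i j : 'I_m) : bil (map_mx intr A : 'M[rat]_m) (delta_mx 0 i) (delta_mx 0 j)
    = (A i j)%:~R.
  rewrite /bil -rowE; rewrite -[delta_mx 0 j]trmxK trmx_delta trmxK -colE.
  by rewrite !mxE.
congr (_ + _); apply: eq_bigr => i _.
  by rewrite qE e ratr_int mxE expr2 mulrCA mulrA.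
apply: eq_bigr => j _.
rewrite (bil_polar _ _ qE) bil_addmx bil_tr !e rmorphD /= !ratr_int !mxE.
by ring.
Qed.

Lemma form_start n (q : 'rV[rat]_n.+1 -> rat) : (2 <= n)%N ->
  diag_form q \/ hyp_form q ->
  exists (A : 'M[int]_n.+1) (y : nat -> 'rV[int]_n.+1),
    (forall t, q t = bil (map_mx intr A) t t) /\ good_start A y.
Proof.
move=> n2 [[a [a1 nsq qE]]|[a [a2 qE]]].
  have [y ys] := @diag_start n a n2 a1 nsq.
  exists (diag_form_mx n a), y; split=> // t.
  rewrite qE /diag_form_mx map_diag_mx bil_diag.
  transitivity (\sum_(0 <= i < n.+1)
      (if i == 0 :> nat then 1 else - (a i)%:~R) * t 0 (inord i) ^+ 2).
    rewrite [RHS]big_ltn//= mul1r (_ : inord 0 = ord0); last first.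
      by apply/val_inj; rewrite /= inordK.
    rewrite -sumrN; congr (_ + _); apply: eq_big_nat => -[|i] // _ /=.
    by rewrite mulNr.
  rewrite big_mkord; apply: eq_bigr => i _; rewrite inord_val !mxE.
  by case: eqP => _; rewrite ?rmorph1 ?rmorphN /=; ring.
have [y ys] := @hyp_start n a n2 a2.
exists (hyp_mx n a), y; split=> // t.
rewrite qE /hyp_mx map_mxD map_delta_mx map_diag_mx bil_addmx bil_delta bil_diag.
congr (_ + _).
transitivity (\sum_(0 <= i < n.+1)
    (if (i < 2)%N then 0 else - (a i)%:~R) * t 0 (inord i) ^+ 2).
  rewrite [RHS]big_ltn//= [X in _ + X]big_ltn//=; last by lia.
  rewrite !mul0r !add0r -sumrN; apply: eq_big_nat => i /andP[i2 _].
  by rewrite ltnNge i2 /= mulNr.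
rewrite big_mkord; apply: eq_bigr => i _; rewrite inord_val !mxE.
by case: ifP => _; rewrite ?rmorph0 ?rmorphN /=; ring.
Qed.
End FormMatrix.

Lemma rat_common_multiple m (c : 'I_m -> rat) :
  exists (e : 'I_m -> int) (a : int),
    a != 0 /\ forall i, (e i)%:~R = a%:~R * c i.
Proof.
case: m c => [|m] c; first by exists (fun=> 0), 1; split=> // -[].
(* The rationals are packed into a polynomial, whose denominators are cleared all at once. *)
have [q [a a0 pE]] := rat_poly_scale (\poly_(i < m.+1) c (inord i)).
exists (fun i => q`_i), a; split=> // i.
have := congr1 (fun p : {poly rat} => p`_i) pE.
rewrite coef_poly ltn_ord inord_val => ->.
by rewrite coefZ coef_map /= mulVKf// intr_eq0.
Qed.

(** Makes row vectors a complete normed space, as [normalized_orbit_cvg] requires. *)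
HB.instance Definition _ (R : realType) m n := Complete.on 'M[R]_(m, n).

(** * The limit point *)

Section Vanishing.
Context {R : realType}.

Definition vanishing (d : nat -> R) : Prop :=
  forall e, 0 < e -> exists N, forall i, (N <= i)%N -> d i <= e.

(** The passages to the limit for xi go through this lemma, with explicit Lipschitz constants in
    place of continuity of b and of the wedge. *)
Lemma le_of_vanishing (d : nat -> R) (a b K : R) (N : nat) :
  vanishing d -> 0 <= K -> (forall i, (N <= i)%N -> a <= b + K * d i) -> a <= b.
Proof.
move=> dv K0 H; rewrite leNgt; apply/negP => ba.
have K1 : 0 < 2 * (K + 1) by lra.
have e0 : 0 < (a - b) / (2 * (K + 1)) by rewrite divr_gt0// subr_gt0.
have [M HM] := dv _ e0.
have := H (maxn N M) (leq_maxl _ _); have := HM (maxn N M) (leq_maxr _ _).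
rewrite ler_pdivlMr// => h1 h2.
have d0 : K * d (maxn N M) <= (a - b) / 2.
  have [dn|dp] := leP (d (maxn N M)) 0; last by nra.
  by apply: (@le_trans _ _ 0); [rewrite mulr_ge0_le0|lra].
lra.
Qed.
End Vanishing.

Section Estimates.
Context {R : realType}.
Variables (n : nat) (A : 'M[int]_n.+1) (z : nat -> 'rV[int]_n.+1) (rho : R).
Hypothesis n2 : (2 <= n)%N.
Hypothesis zg : growing_orbit A z.
Hypothesis rho_gt0 : 0 < rho.
Hypothesis rho_root : rho ^+ n = \sum_(k < n) rho ^+ k.

Let b (k l : nat) : R := (bil (A + A^T) (z k) (z l))%:~R.
Let S : 'M[R]_n.+1 := map_mx intr (A + A^T).
Let zR i : 'rV[R]_n.+1 := ivec R (z i).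
Let P i : R := `|gprod b i|.

Let bE k l : bil S (zR k) (zR l) = b k l.
Proof. exact: bil_ivec. Qed.

Let b3 l j : (l < j)%N -> 3 <= `|b j l|.
Proof.
move=> lj; case: zg => _ _ _ _ [/(_ l j lj) h _ _ _ _].
by rewrite -intr_norm -[3]/(3%:~R) ler_int.
Qed.

Let b2 l j : (l < j)%N -> 2 * `|b j l| <= `|b j.+1 l|.
Proof.
move=> lj; case: zg => _ _ _ _ [_ /(_ l j lj) h _ _ _].
by rewrite -!intr_norm -[2]/(2%:~R) -intrM ler_int.
Qed.

Let bd l j : (l < j)%N ->
  `|b j.+1 l - b j.+1 j * b j l| <= Num.max `|b j.+1 j| `|b j l|.
Proof.
move=> lj; case: zg => _ _ _ _ [_ _ /(_ l j lj) + _ _].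
rewrite !le_max /b -intrM -intrB -!intr_norm !ler_int.
by [].
Qed.

Let bb j : 2 * `|b j.+1 j| <= `|b j.+2 j.+1|.
Proof.
case: zg => _ _ _ _ [_ _ _ /(_ j) h _].
by rewrite -!intr_norm -[2]/(2%:~R) -intrM ler_int.
Qed.

Let bn j : b (j + n)%N j = b (j + n).+1 (j + n)%N.
Proof. by case: zg => _ _ _ _ [_ _ _ _ h]; rewrite /b h. Qed.

Lemma real_rec j : zR (j + n).+1 = b (j + n).+1 (j + n)%N *: zR (j + n)%N - zR j.
Proof.
rewrite -bn /zR -addnS; case: zg => -> _ _ _ _.
by apply/rowP => i; rewrite !mxE rmorphB rmorphM.
Qed.

Lemma b_diag i : b i i = 2.
Proof. by rewrite /b bil_sym_diag; case: zg => _ -> _ _ _. Qed.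

Let P_gt0 i : 0 < P i. Proof. exact: gnorm_gt0 b3 i. Qed.

Let P_ge0 i : 0 <= P i. Proof. exact: ltW (P_gt0 i). Qed.

Lemma gnorm_ge_nat i : i%:R <= P i /\ 1 <= P i.
Proof.
elim: i => [|i [IH1 IH2]]; first by rewrite /P gnorm0.
have := gnormS b i; rewrite -![`|gprod b _|]/(P _) => ->.
have := beta_ge3 b3 i; rewrite -natr1 /= => h.
by split; nra.
Qed.

Lemma vanishing_invP : vanishing (fun i => (P i)^-1).
Proof.
move=> e e0; exists (Num.bound e^-1) => i Ni.
rewrite -[leRHS]invrK lef_pV2 ?posrE ?invr_gt0//.
apply: le_trans (gnorm_ge_nat i).1; apply: le_trans (ltW (archi_boundP _)) _.
  by rewrite invr_ge0 ltW.
by rewrite ler_nat.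
Qed.

Lemma size_upper : exists2 C, 0 < C & forall i, `|zR i| <= C * P i.
Proof. exact: (orbit_norm_upper b3 bb real_rec). Qed.

(** Pairing with the fixed vector z_0 suffices, since |b(z_i, z_0)| >= P_i / 3 for i > 0. *)
Lemma size_lower : exists2 C, 0 < C & forall i, P i <= C * `|zR i|.
Proof.
pose K := n.+1%:R * n.+1%:R * `|S|.
have K0 : 0 <= K by rewrite !mulr_ge0.
have bK k l : `|b k l| <= K * `|zR k| * `|zR l| by rewrite -bE bil_norm.
exists (3 * (K * `|zR 0%N|) + 1) => [|[|i]].
- by rewrite ltr_wpDl// !mulr_ge0.
- have := bK 0%N 0%N; rewrite b_diag [P 0]gnorm0 ger0_norm// => h.
  have := normr_ge0 (zR 0%N); move: h; move: (`|zR 0%N|) => t h t0; nra.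
- have h := B_lower b3 b2 bd bb (ltn0Sn i); rewrite gnorm0 mulr1 in h.
  apply: le_trans h _; apply: le_trans (ler_wpM2l _ (bK _ _)) _ => //.
  rewrite [leRHS]mulrDl mul1r.
  rewrite (_ : 3 * (K * `|zR i.+1| * `|zR 0%N|) = 3 * (K * `|zR 0%N|) * `|zR i.+1|); last by ring.
  by rewrite lerDl.
Qed.

Lemma zR_neq0 i : zR i != 0.
Proof.
have [C C0 h] := size_lower; apply/eqP => e; have := h i.
by rewrite e normr0 mulr0 leNgt P_gt0.
Qed.

Let W k l := wedge (zR k) (zR l).

Lemma W_upper : exists2 C, 0 < C & forall l j, (l < j)%N ->
  `|W j l| * P l <= C * P j.
Proof.
apply: (wedge_norm_upper n2 b3 b2 bd bb bn).
- by move=> k l; rewrite /W wedgeC normrN.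
- by move=> k; exact: wedgexx.
- by move=> j l; rewrite /W real_rec wedgeBl wedgeZl.
Qed.

(* Contracting [W k l] with [zR k] or [zR l] gives [2 zR l - b k l zR k] or
   [b k l zR l - 2 zR k]; the larger vector dominates in one of these. *)
Lemma W_lower : exists2 C, 0 < C & forall l k, (l < k)%N -> `|b k l| <= C * `|W k l|.
Proof.
pose K := n.+1%:R * (n.+1%:R * `|S|).
have K0 : 0 <= K by rewrite !mulr_ge0.
exists (3 * K + 1) => [|l k lk]; first by rewrite ltr_wpDl// mulr_ge0.
have con i : `|b i k *: zR l - b i l *: zR k| <= K * `|zR i| * `|W k l|.
  have -> : b i k *: zR l - b i l *: zR k = (zR i *m S) *m W k l.
    by rewrite mul_rV_wedge -!bE.
  apply: le_trans (mx_norm_mul _ _) _; rewrite ler_wpM2r// /K -!mulrA ler_wpM2l//.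
  by apply: le_trans (mx_norm_mul _ _) _; rewrite -!mulrA ler_wpM2l// mulrC.
have bs : b l k = b k l by rewrite /b bil_sym.
(* As |b k l| >= 3, the left side is at least |b k l| / 3, whence the constant 3 K. *)
suff h : `|b k l| - 2 <= K * `|W k l|.
  have := b3 lk; have := normr_ge0 (W k l); move: h.
  by move: (`|W k l|) (`|b k l|) => w t; nra.
have main (t w : 'rV[R]_n.+1) : t != 0 -> `|w| <= `|t| ->
    `|2 *: w - b k l *: t| <= K * `|t| * `|W k l| ->
    `|b k l| - 2 <= K * `|W k l|.
  move=> t0 wt h; rewrite -normr_gt0 in t0.
  rewrite -(ler_pM2r t0) mulrAC; apply: le_trans h.
  rewrite distrC; apply: le_trans (lerB_dist _ _); rewrite !normrZ.
  by rewrite (ger0_norm (ler0n _ 2)) mulrBl lerD2l lerN2 ler_wpM2l.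
have [le|/ltW le] := leP `|zR l| `|zR k|.
  by apply: (main (zR k) (zR l)); rewrite ?zR_neq0// -(b_diag k).
apply: (main (zR l) (zR k)); rewrite ?zR_neq0//.
by rewrite distrC -bs -(b_diag l).
Qed.

Lemma growth : exists2 C, 0 < C & forall i,
  P i.+1 <= C * P i `^ rho /\ P i `^ rho <= C * P i.+1.
Proof. exact: (gnorm_powR n2 b3 b2 bd bb bn rho_gt0 rho_root). Qed.

Let u i : 'rV[R]_n.+1 := (gprod b i)^-1 *: zR i.

Lemma u_neq0 i : u i != 0.
Proof. by rewrite scaler_eq0 invr_eq0 (negPf (gprod_neq0 b3 i)) (negPf (zR_neq0 i)). Qed.

Lemma u_norm i : `|u i| * P i = `|zR i|.
Proof. by rewrite normrZ normfV mulrAC mulVf ?mul1r// gt_eqF// P_gt0. Qed.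

Lemma limit_exists : exists xi : 'rV[R]_n.+1, u @ \oo --> xi.
Proof.
have /cvg_ex[xi h] := @normalized_orbit_cvg R n b b3 bb 'rV[R]_n.+1 zR real_rec.
by exists xi.
Qed.

Section Limit.
Variable xi : 'rV[R]_n.+1.
Hypothesis uxi : u @ \oo --> xi.

Lemma vanishing_dist : vanishing (fun i => `|xi - u i|).
Proof.
move=> e e0; have /cvgrPdist_le/(_ e e0)[N _ HN] := uxi.
by exists N => i; exact: HN.
Qed.

Lemma limit_neq0 : xi != 0.
Proof.
have [C C0 h] := size_lower; rewrite -normr_gt0.
apply: lt_le_trans (_ : C^-1 <= _); first by rewrite invr_gt0.
apply: (@le_of_vanishing _ _ _ _ 1 0%N vanishing_dist) => // i _.
apply: (@le_trans _ _ `|u i|).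
  rewrite -(ler_pM2r (P_gt0 i)) u_norm mulrC ler_pdivrMr//.
  by rewrite mulrC h.
by rewrite mul1r -{1}[u i](subKr xi); apply: ler_normB.
Qed.

(** The rescaled vectors satisfy b(u_i, u_i) = 2 / P_i^2, which tends to 0. *)
Lemma limit_isotropic : bil S xi xi = 0.
Proof.
apply/eqP; rewrite -normr_eq0 eq_le normr_ge0 andbT.
pose K := n.+1%:R * n.+1%:R * `|S|.
have K0 : 0 <= K by rewrite !mulr_ge0.
pose d i := `|xi - u i| + (P i)^-1.
have dv : vanishing d.
  move=> e e0; have e2 : 0 < e / 2 by rewrite divr_gt0.
  have [N1 h1] := vanishing_dist e2; have [N2 h2] := vanishing_invP e2.
  exists (maxn N1 N2) => i; rewrite geq_max => /andP[i1 i2].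
  by have := h1 i i1; have := h2 i i2; rewrite /d; lra.
have [C C0 zC] := size_upper.
apply: (@le_of_vanishing _ _ _ _ (K * `|xi| + K * C + 2) 0%N dv).
  by rewrite !addr_ge0 ?mulr_ge0// ltW.
move=> i _; rewrite add0r.
have uC : `|u i| <= C by rewrite -(ler_pM2r (P_gt0 i)) u_norm.
have e : bil S xi xi = bil S (xi - u i) xi + bil S (u i) (xi - u i)
    + bil S (u i) (u i).
  have -> : bil S (u i) (xi - u i) = bil S (u i) xi - bil S (u i) (u i).
    by rewrite -scaleN1r bilDr bilZr mulN1r.
  by rewrite bilBl; ring.
have uu : `|bil S (u i) (u i)| <= 2 * (P i)^-1.
  rewrite bilZl bilZr bE b_diag !normrM normfV -/(P i) (ger0_norm (ler0n _ 2)).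
  have p1 : (P i)^-1 <= 1 by rewrite invf_le1// (gnorm_ge_nat i).2.
  have : 0 <= (P i)^-1 by rewrite invr_ge0.
  by move: ((P i)^-1) p1 => t t1 t0; nra.
have h1 : `|bil S (xi - u i) xi| <= K * `|xi| * `|xi - u i|.
  by apply: le_trans (bil_norm _ _ _) _; rewrite mulrAC.
have h2 : `|bil S (u i) (xi - u i)| <= K * C * `|xi - u i|.
  apply: le_trans (bil_norm _ _ _) _; rewrite ler_wpM2r//.
  by rewrite ler_wpM2l.
rewrite e; apply: le_trans (ler_normD _ _) _.
apply: le_trans (lerD (ler_normD _ _) (lexx _)) _.
apply: le_trans (lerD (lerD h1 h2) uu) _.
rewrite /d; have := normr_ge0 (xi - u i); have : 0 <= (P i)^-1 by rewrite invr_ge0.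
have : 0 <= K * `|xi| by rewrite mulr_ge0.
have : 0 <= K * C by rewrite mulr_ge0 ?(ltW C0).
move: (K * `|xi|) (K * C) (`|xi - u i|) ((P i)^-1) => a c x y; nra.
Qed.

(** The quotient is the norm of the wedge of u_i with z_l. For fixed l and growing i, bounds on [W]
    become bounds on the wedge of xi with z_l. *)
Let wedge_dist l i : `| `|wedge xi (zR l)| - `|W i l| / P i| <=
  2 * `|zR l| * `|xi - u i|.
Proof.
have -> : `|W i l| / P i = `|wedge (u i) (zR l)|.
  by rewrite wedgeZl normrZ normfV mulrC.
apply: le_trans (ler_dist_dist _ _) _; rewrite -wedgeBl.
by apply: le_trans (wedge_norm _ _) _; rewrite mulrAC.
Qed.

Lemma dist_upper : exists2 C, 0 < C & forall l, `|wedge xi (zR l)| * P l <= C.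
Proof.
have [C C0 WC] := W_upper; exists C => // l.
rewrite -ler_pdivlMr//.
apply: (@le_of_vanishing _ _ _ _ (2 * `|zR l|) l.+1 vanishing_dist).
  by rewrite mulr_ge0.
move=> i li; have := wedge_dist l i; rewrite ler_norml => /andP[_ h].
rewrite lerBlDl in h; apply: le_trans h _; rewrite lerD2r.
by rewrite ler_pdivlMr// mulrAC ler_pdivrMr// WC.
Qed.

Lemma dist_lower : exists2 C, 0 < C & forall l, 1 <= C * (`|wedge xi (zR l)| * P l).
Proof.
have [C C0 WC] := W_lower; exists (3 * C) => [|l]; first by rewrite mulr_gt0.
have c0 : 0 < 3 * C * P l by rewrite !mulr_gt0.
suff h : (3 * C * P l)^-1 <= `|wedge xi (zR l)|.
  rewrite (_ : 3 * C * _ = `|wedge xi (zR l)| * (3 * C * P l)); last by ring.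
  by rewrite -ler_pdivrMr// mul1r.
apply: (@le_of_vanishing _ _ _ _ (2 * `|zR l|) l.+1 vanishing_dist).
  by rewrite mulr_ge0.
move=> i li; have := wedge_dist l i; rewrite ler_norml => /andP[h _].
have h2 : (3 * C * P l)^-1 <= `|W i l| / P i.
  rewrite ler_pdivlMr// mulrC ler_pdivrMr//.
  apply: le_trans (B_lower b3 b2 bd bb li) _.
  rewrite (_ : `|W i l| * (3 * C * P l) = 3 * (C * `|W i l| * P l)); last by ring.
  by rewrite ler_wpM2l// ler_wpM2r// WC.
lra.
Qed.

(* A rational relation [c] on [xi] turns into the bound
   [|c . z l| |xi| <= C |xi /\ z l|], whose right-hand side tends to 0, so the
   integers [c . z l] eventually vanish. *)
Lemma limit_Q_lin_indep : Q_lin_indep xi.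
Proof.
move=> c cxi; have [e [a [a0 eE]]] := rat_common_multiple c.
pose eR : 'rV[R]_n.+1 := \row_i (e i)%:~R.
pose f l : int := ((\row_i e i) *m (z l)^T) 0 0.
have e_xi : (eR *m xi^T) 0 0 = 0.
  transitivity (a%:~R * \sum_i ratr (c i) * xi 0 i); last by rewrite cxi mulr0.
  rewrite mxE mulr_sumr; apply: eq_bigr => i _.
  by rewrite !mxE mulrA -(ratr_int R a) -rmorphM /= -eE ratr_int.
have e_z l : (eR *m (zR l)^T) 0 0 = (f l)%:~R.
  rewrite /f !mxE rmorph_sum /=; apply: eq_bigr => i _.
  by rewrite !mxE rmorphM.
have xi0 : 0 < `|xi| by rewrite normr_gt0 limit_neq0.
have [C C0 hC] := dist_upper.
pose K := n.+1%:R * `|eR|.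
have K0 : 0 <= K by rewrite mulr_ge0.
have fb l : `|f l|%:~R * `|xi| * P l <= K * C.
  apply: (@le_trans _ _ (K * `|wedge xi (zR l)| * P l)); last first.
    by rewrite -mulrA ler_wpM2l.
  rewrite ler_wpM2r// intr_norm -e_z -normrZ.
  apply: le_trans (mx_norm_mul _ _); rewrite mul_rV_wedge e_xi scale0r sub0r.
  by rewrite normrN.
(* Once 1 / P_l is below this threshold, |xi| P_l exceeds K C, so [fb] leaves no nonzero value to
   the integer f l. *)
have e0 : 0 < `|xi| / (2 * (K * C + 1)).
  by rewrite divr_gt0// mulr_gt0// ltr_wpDl// mulr_ge0// ltW.
have [L HL] := vanishing_invP e0.
have f0 l : (L <= l)%N -> f l = 0.
  move=> Ll; apply/eqP; rewrite -normr_eq0 eq_le normr_ge0 andbT leNgt.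
  apply/negP; rewrite gtz0_ge1 -(ler_int R) => f1.
  have := HL l Ll; rewrite -[(P l)^-1]mul1r ler_pdivrMr// => h.
  have := fb l; have : 1 * `|xi| * P l <= `|f l|%:~R * `|xi| * P l.
    by rewrite !ler_wpM2r// ltW.
  have KC : 0 <= K * C by rewrite mulr_ge0// ltW.
  have : 2 * (K * C + 1) <= `|xi| * P l.
    rewrite mulrAC ler_pdivlMr in h; last by rewrite mulr_gt0// ltr_wpDl.
    by rewrite mul1r in h.
  by rewrite mul1r; lra.
(* The integral linear form e kills n + 1 consecutive vectors; their determinant is nonzero, so e =
   0. *)
have det0 : \det (\matrix_(k < n.+1) z (L + k)%N) != 0.
  by case: zg => _ _ /(_ L) h d0 _; rewrite -normr_eq0 h normr_eq0.
have ei0 i : e i = 0.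
  have ker : (\row_i e i) *m (\matrix_(k < n.+1) z (L + k)%N)^T = 0.
    apply/rowP => k; rewrite [RHS]mxE -[RHS](f0 (L + k)%N) ?leq_addr//.
    by rewrite /f !mxE; apply: eq_bigr => j _; rewrite !mxE.
  have [//|ne] := eqVneq (e i) 0.
  move: det0; rewrite -det_tr => /negP[]; apply/det0P; exists (\row_i e i) => //.
  by apply/eqP => /rowP/(_ i); rewrite !mxE => ei; rewrite ei eqxx in ne.
move=> i; have := eE i; rewrite ei0 => /esym/eqP.
by rewrite mulf_eq0 intr_eq0 (negPf a0) => /eqP.
Qed.

End Limit.

Lemma orbit_estimates : exists (Q g : nat -> R) (xi : 'rV[R]_n.+1),
  [/\ forall i, 0 < Q i /\ i%:R <= Q i,
      asymp (fun i => Q i.+1) (fun i => Q i `^ rho),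
      asymp (fun i => `|zR i|) Q,
      asymp (fun i => `|W i.+1 i|) (fun i => Q i.+1 / Q i) &
      [/\ forall i, g i *: zR i != 0,
          (fun i => g i *: zR i) @ \oo --> xi,
          [/\ xi != 0, bil S xi xi = 0 & Q_lin_indep xi] &
          asymp (fun i => `|wedge xi (zR i)|) (fun i => (Q i)^-1)]].
Proof.
have [xi uxi] := limit_exists.
exists P, (fun i => (gprod b i)^-1), xi; split.
- by move=> i; split; [exact: P_gt0|have [] := gnorm_ge_nat i].
- by have [C C0 h] := growth; split; exists C => // i; have [] := h i.
- by split; [exact: size_upper|exact: size_lower].
- split.
    have [C C0 h] := W_upper; exists C => // i.
    by rewrite mulrA ler_pdivlMr// h.
  have [C C0 h] := W_lower; exists C => // i.
  by rewrite [P i.+1]gnormS mulfK ?gt_eqF ?h// P_gt0.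
split.
- exact: u_neq0.
- exact: uxi.
- split; [exact: limit_neq0|exact: limit_isotropic|exact: limit_Q_lin_indep].
split.
  have [C C0 h] := dist_upper uxi; exists C => // i.
  by rewrite ler_pdivlMr// h.
have [C C0 h] := dist_lower uxi; exists C => // i.
by rewrite -[leLHS]mul1r ler_pdivrMr// -mulrA h.
Qed.
End Estimates.

(** * Asymptotic comparison and conclusion *)

Section Asymp.
Context {R : realType}.
Implicit Types u v w : nat -> R.

Lemma ll_trans u v w : ll u v -> ll v w -> ll u w.
Proof.
move=> [C C0 h] [D D0 h']; exists (C * D) => [|i]; first exact: mulr_gt0.
by apply: le_trans (h i) _; rewrite -mulrA ler_pM2l.
Qed.

Lemma asymp_sym u v : asymp u v -> asymp v u.
Proof. by case. Qed.

Lemma asymp_trans u v w : asymp u v -> asymp v w -> asymp u w.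
Proof.
by move=> [a b] [c d]; split; [exact: ll_trans a c|exact: ll_trans d b].
Qed.

Lemma asymp_shift u v : asymp u v -> asymp (fun i => u i.+1) (fun i => v i.+1).
Proof. by move=> [[C C0 h] [D D0 h']]; split; [exists C|exists D]. Qed.

Lemma ll_mul u v u' v' : (forall i, 0 <= u i) -> (forall i, 0 <= u' i) ->
  ll u v -> ll u' v' -> ll (fun i => u i * u' i) (fun i => v i * v' i).
Proof.
move=> u0 u'0 [C C0 h] [D D0 h']; exists (C * D) => [|i]; first exact: mulr_gt0.
by rewrite mulrACA ler_pM.
Qed.

Lemma asymp_mul u v u' v' : (forall i, 0 <= u i) -> (forall i, 0 <= v i) ->
  (forall i, 0 <= u' i) -> (forall i, 0 <= v' i) ->
  asymp u v -> asymp u' v' -> asymp (fun i => u i * u' i) (fun i => v i * v' i).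
Proof. by move=> u0 v0 u'0 v'0 [a b] [c d]; split; exact: ll_mul. Qed.

Lemma ll_inv u v : (forall i, 0 < u i) -> (forall i, 0 < v i) ->
  ll u v -> ll (fun i => (v i)^-1) (fun i => (u i)^-1).
Proof.
move=> u0 v0 [C C0 h]; exists C => // i.
by rewrite ler_pdivlMr// mulrC ler_pdivrMr// h.
Qed.

Lemma asymp_inv u v : (forall i, 0 < u i) -> (forall i, 0 < v i) ->
  asymp u v -> asymp (fun i => (u i)^-1) (fun i => (v i)^-1).
Proof. by move=> u0 v0 [a b]; split; exact: ll_inv. Qed.

Lemma asymp_div u v u' v' : (forall i, 0 < u i) -> (forall i, 0 < v i) ->
  (forall i, 0 < u' i) -> (forall i, 0 < v' i) ->
  asymp u v -> asymp u' v' -> asymp (fun i => u i / u' i) (fun i => v i / v' i).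
Proof.
move=> u0 v0 u'0 v'0 a b; apply: asymp_mul => //; first [by move=> i; rewrite ltW//
  | by move=> i; rewrite invr_ge0 ltW | exact: asymp_inv].
Qed.

Lemma ll_powR u v r : 0 <= r -> (forall i, 0 <= u i) -> (forall i, 0 <= v i) ->
  ll u v -> ll (fun i => u i `^ r) (fun i => v i `^ r).
Proof.
move=> r0 u0 v0 [C C0 h]; exists (C `^ r) => [|i]; first exact: powR_gt0.
rewrite -powRM ?(ltW C0)//; apply: ge0_ler_powR; rewrite ?nnegrE ?mulr_ge0 ?(ltW C0)//.
Qed.

Lemma asymp_powR u v r : 0 <= r -> (forall i, 0 <= u i) -> (forall i, 0 <= v i) ->
  asymp u v -> asymp (fun i => u i `^ r) (fun i => v i `^ r).
Proof. by move=> r0 u0 v0 [a b]; split; exact: ll_powR. Qed.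

Lemma asymp_enorm m (x : nat -> 'rV[R]_m.+1) :
  asymp (fun i => enorm (x i)) (fun i => `|x i|).
Proof.
split; first by exists m.+1%:R => [//|i]; exact: enorm_le.
by exists 1 => // i; rewrite mul1r; exact: enorm_ge.
Qed.

Lemma asymp_wnorm m (x y : nat -> 'rV[R]_m.+1) :
  asymp (fun i => wnorm (wedge (x i) (y i))) (fun i => `|wedge (x i) (y i)|).
Proof.
split; first by exists m.+1%:R => [//|i]; exact: wnorm_le.
by exists 1 => // i; rewrite mul1r; exact: wnorm_ge.
Qed.

Lemma asympZ u v (c : R) : 0 < c -> asymp u v -> asymp (fun i => u i / c) v.
Proof.
move=> c0 [[C C0 h] [D D0 h']]; split.
  exists (C / c) => [|i]; first exact: divr_gt0.
  by rewrite mulrAC ler_pM2r ?invr_gt0.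
exists (D * c) => [|i]; first exact: mulr_gt0.
by rewrite -mulrA [c * _]mulrC mulfVK ?gt_eqF.
Qed.

End Asymp.

Section Final.
Context {R : realType}.
Variables (n : nat) (q : 'rV[rat]_n.+1 -> rat) (A : 'M[int]_n.+1).
Hypothesis qE : forall t, q t = bil (map_mx intr A) t t.

Lemma qextZ (c : R) (t : 'rV[R]_n.+1) : qext q (c *: t) = c ^+ 2 * qext q t.
Proof. by rewrite !(qext_bil qE) bilZl bilZr mulrA expr2. Qed.

Lemma ivec_notin_Zset (x : 'rV[int]_n.+1) : bil A x x = 1 ->
  ivec R x != 0 -> ~ Zset q (pt (ivec R x)).
Proof.
move=> x1 x0 [v [v0 qv]] /(pt_eqP v0 x0)[c c0 e].
move: qv; rewrite e qextZ (qext_bil qE) bil_ivec x1 mulr1 => /eqP.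
by rewrite sqrf_eq0 (negPf c0).
Qed.

Lemma ivec_ratpts (x : 'rV[int]_n.+1) : ivec R x != 0 ->
  (@ratpts R n) (pt (ivec R x)).
Proof.
move=> x0; exists (ivec rat x); last by rewrite map_ivec.
by apply: contraNneq x0 => x0; rewrite -(map_ivec (ratr : {rmorphism rat -> R})) x0 map_mx0.
Qed.

Lemma isotropic_qext (t : 'rV[R]_n.+1) :
  bil (map_mx intr (A + A^T)) t t = 0 -> qext q t = 0.
Proof.
rewrite map_mxD -matrix.map_trmx bil_sym_diag (qext_bil qE) => /eqP.
by rewrite mulrn_eq0 /= => /eqP.
Qed.

Lemma Dist_pt (xi : 'rV[R]_n.+1) (x : 'rV[int]_n.+1) : xi != 0 ->
  Dist (pt xi) x = wnorm (wedge (ivec R x) xi) / enorm xi.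
Proof.
move=> xi0; rewrite /Dist; have [c c0 ->] := rvec_pt xi0.
rewrite wedgeZr wnormZ enormZ invfM mulrACA divff ?mul1r// normr_eq0//.
Qed.

Lemma calD_le (xi : projspace R n) (Y : R) (E : set (projspace R n))
    (x : 'rV[int]_n.+1) :
  x != 0 -> enorm (ivec R x) <= Y -> E (pt (ivec R x)) ->
  (calD xi Y E <= (Dist xi x)%:E)%E.
Proof.
move=> x0 xY Ex; have Dx : Dist_values xi Y E (Dist xi x) by exists x.
have [m [_ ml ->]] := calD_attained (ex_intro _ _ Dx).
by rewrite lee_fin; exact: ml.
Qed.

(* If [c Q i <= Y < c Q i.+1], then [x i] is an admissible point for [Y]. *)
Lemma limf_esup_calD (rho : R) (Q : nat -> R) (x : nat -> 'rV[int]_n.+1)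
    (xi : projspace R n) (E : set (projspace R n)) :
  0 < rho -> (forall i, 0 < Q i /\ i%:R <= Q i) ->
  ll (fun i => Q i.+1) (fun i => Q i `^ rho) ->
  (forall i, x i != 0 /\ E (pt (ivec R (x i)))) ->
  ll (fun i => enorm (ivec R (x i))) Q ->
  ll (fun i => Dist xi (x i)) (fun i => (Q i)^-1) ->
  (limf_esup (fun Y : R => (Y `^ rho^-1)%:E * calD xi Y E) (pinfty_nbhs R)
         < +oo)%E.
Proof.
move=> rho0 Qge [C C0 QC] xE [c c0 xc] [D D0 xD].
have Q0 i : 0 < Q i by have [] := Qge i.
pose M := (c * C) `^ rho^-1 * D.
apply: (@le_lt_trans _ _ M%:E); last exact: ltry.
rewrite limf_esupE; apply: ge_ereal_inf.
exists (ereal_sup ((fun Y : R => ((Y `^ rho^-1)%:E * calD xi Y E)%E)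
  @` [set Y | c * Q 0%N <= Y])).
  exists [set Y | c * Q 0%N <= Y] => //.
  exact: nbhs_pinfty_ge (num_real _).
apply: ge_ereal_sup => _ [Y /= Y0 <-].
have ex : exists k, Y < c * Q k.
  exists (Num.bound `|Y / c|); rewrite mulrC -ltr_pdivrMr//.
  apply: lt_le_trans (Qge _).2; apply: le_lt_trans (ler_norm _) _.
  by apply: archi_boundP; rewrite normr_ge0.
(* The least k with Y < c Q_k is not 0, as Y lies in the chosen tail; its predecessor is the index
   i. *)
case: (ex_minnP ex) => -[|i] Yk kmin; first by rewrite ltNge Y0 in Yk.
have cQY : c * Q i <= Y.
  by rewrite leNgt; apply/negP => /kmin; rewrite ltnn.
have [x0 Ex] := xE i.
have le1 := calD_le xi x0 (le_trans (xc i) cQY) Ex.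
have Yr0 : 0 <= Y `^ rho^-1 by exact: powR_ge0.
have r0 : 0 <= rho^-1 by rewrite invr_ge0 ltW.
apply: le_trans (lee_wpmul2l _ le1) _; first by rewrite lee_fin.
rewrite -EFinM lee_fin.
have Dpos : 0 <= Dist xi (x i) by rewrite divr_ge0// sqrtr_ge0.
(* From Y < c Q_{i+1} <= c C Q_i^rho; the factor Q_i then cancels against the distance D / Q_i. *)
have Yle : Y `^ rho^-1 <= (c * C) `^ rho^-1 * Q i.
  apply: (@le_trans _ _ ((c * C * Q i `^ rho) `^ rho^-1)).
    apply: ge0_ler_powR; rewrite ?nnegrE ?mulr_ge0 ?powR_ge0 ?(ltW c0) ?(ltW C0)//.
      by apply: le_trans cQY; rewrite mulr_ge0 ?ltW.
    by apply: le_trans (ltW Yk) _; rewrite -mulrA ler_wpM2l ?QC ?(ltW c0).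
  rewrite powRM ?mulr_ge0 ?powR_ge0 ?(ltW c0) ?(ltW C0)//.
  by rewrite -powRrM mulfV ?gt_eqF// powRr1 ?(ltW (Q0 i)).
have xDi : Dist xi (x i) <= D * (Q i)^-1 := xD i.
have -> : M = (c * C) `^ rho^-1 * Q i * (D * (Q i)^-1).
  by rewrite mulrACA mulfV ?mulr1// gt_eqF.
exact: ler_pM.
Qed.

End Final.

Theorem theorem8p1 (R : realType) (n : nat) (q : 'rV[rat]_n.+1 -> rat) (rho : R)
    (hn : (2 <= n)%N)
    (hq : diag_form q \/ hyp_form q)
    (hrho : 0 < rho /\ root (rho_poly R n) rho) :
  let Z : set (projspace R n) := Zset q in
  let E : set (projspace R n) := @ratpts R n `\` Z in
  exists x : nat -> 'rV[int]_n.+1,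
    let X : nat -> R := fun i => enorm (ivec R (x i)) in
    (forall B : R, exists i, B < X i) /\
    (forall i, ivec rat (x (i + n.+1)%N)
               = psi q (ivec rat (x (i + n)%N)) (ivec rat (x i))) /\
    (forall i, q (ivec rat (x i)) = 1) /\
    (forall i,
       `|\det (\matrix_(k < n.+1) x (i + k)%N)|
         = `|\det (\matrix_(k < n.+1) x k)|
       /\ `|\det (\matrix_(k < n.+1) x k)| != 0) /\
    asymp (fun i => X i.+1) (fun i => X i `^ rho) /\
    asymp (fun i => wnorm (wedge (ivec R (x i.+1)) (ivec R (x i))))
          (fun i => X i.+1 / X i) /\
    exists xi : projspace R n,
      (fun i => pt (ivec R (x i))) @ \oo --> xi /\
      Zli q xi /\
      asymp (fun i => Dist xi (x i)) (fun i => (X i)^-1) /\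
      (limf_esup (fun Y : R => (Y `^ rho^-1)%:E * calD xi Y E) (pinfty_nbhs R)
         < +oo)%E.
Proof.
move=> Z E; have [rho0 rho_root] := hrho.
have rhoE : rho ^+ n = \sum_(k < n) rho ^+ k.
  move: rho_root; rewrite /root /rho_poly !hornerE horner_sum subr_eq0 => /eqP->.
  by apply: eq_bigr => k _; rewrite !hornerE.
have [A [y [qE ys]]] := form_start hn hq.
have [x xg] := growing_orbit_exists hn ys.
have [Q [g [v [Qge Qrho xQ WQ [gx0 gxv [v0 v_iso v_li] vQ]]]]] :=
  orbit_estimates hn xg rho0 rhoE.
have [x_rec x_norm x_det x_det0 _] := xg.
have Q0 i : 0 < Q i by have [] := Qge i.
exists x => X.
have x0 i : ivec R (x i) != 0.
  by apply: contraNneq (gx0 i) => ->; rewrite scaler0.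
have xi0 i : x i != 0.
  by apply: contraNneq (x0 i) => ->; apply/eqP/rowP => j; rewrite !mxE.
have XQ : asymp X Q by apply: asymp_trans xQ; exact: asymp_enorm.
have X0 i : 0 < X i.
  by apply: lt_le_trans (enorm_ge _); rewrite normr_gt0.
have qx i : q (ivec rat (x i)) = 1 by rewrite qE bil_ivec x_norm.
have XE i : E (pt (ivec R (x i))).
  by split; [exact: ivec_ratpts|exact: ivec_notin_Zset (x_norm i) (x0 i)].
have DQ : asymp (fun i => Dist (pt v) (x i)) (fun i => (Q i)^-1).
  under eq_fun do rewrite Dist_pt//.
  apply: asympZ; first by apply: lt_le_trans (enorm_ge _); rewrite normr_gt0.
  apply: asymp_trans vQ; apply: asymp_trans (asymp_wnorm _ _) _.
  under eq_fun do rewrite wedgeC normrN.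
  by split; exists 1 => // i; rewrite mul1r.
split.
  move=> B; have [_ [C C0 QX]] := XQ.
  exists (Num.bound (`|B| * C)); rewrite -(ltr_pM2r C0).
  apply: lt_le_trans (_ : (Num.bound (`|B| * C))%:R <= _).
    apply: le_lt_trans (_ : `|B| * C < _); first by rewrite ler_wpM2r ?ler_norm ?(ltW C0).
    by apply: archi_boundP; rewrite mulr_ge0 ?(ltW C0).
  by apply: le_trans (Qge _).2 _; rewrite [leRHS]mulrC; exact: QX.
split.
  move=> i; rewrite /psi qx scale1r x_rec (bil_polar _ _ qE).
  apply/rowP => j; rewrite !mxE rmorphB rmorphM /=; congr (_ * _ - _).
  by rewrite -bil_ivec map_mxD matrix.map_trmx.
split=> //; split.
  by move=> i; rewrite normr_eq0 x_det0 x_det.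
split.
  apply: asymp_trans (asymp_shift XQ) _; apply: asymp_trans Qrho _.
  by apply: asymp_sym; apply: asymp_powR => //; first [exact: ltW | by move=> i; exact: ltW].
split.
  apply: asymp_trans (asymp_wnorm _ _) _; apply: asymp_trans WQ _.
  by apply: asymp_sym; apply: asymp_div => //; exact: asymp_shift.
exists (pt v); split.
  (* The factors g_i, signs included, do not change the points, and only the rescaled vectors
     converge in the vector space. *)
  have -> : (fun i => pt (ivec R (x i))) = (fun i => pt (g i *: ivec R (x i))).
    apply/funext => i; apply/esym/pt_eqP => //; exists (g i) => //.
    by apply: contraNneq (gx0 i) => ->; rewrite scale0r.
  exact: pt_cvg.
split.
  by split; exists v => //; split=> //; exact: isotropic_qext.
split.
  by apply: asymp_trans DQ _; apply: asymp_sym; exact: asymp_inv.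
by apply: (limf_esup_calD rho0 Qge Qrho.1 _ XQ.1 DQ.1).
Qed.
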